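(* Let $N\ge0$, $\mathbf a_N=(a(0),\dots,a(N))\in\mathbb C^{N+1}$, $\varepsilon_1,\varepsilon_2>0$, let $f_1,g_1$ be given bounded spectral densities, and $D=D_{2\varepsilon_1}\times D_{1\varepsilon_2}$ with $$D_{2\varepsilon_1}=\left\{f:\frac1{2\pi}\int_{-\pi}^\pi|f-f_1|^2d\lambda\le\varepsilon_1\right\},\qquad D_{1\varepsilon_2}=\left\{g:\frac1{2\pi}\int_{-\pi}^\pi|g-g_1|d\lambda\le\varepsilon_2\right\}.$$ Let $f_0\in D_{2\varepsilon_1}$, $g_0\in D_{1\varepsilon_2}$ satisfy $\int_{-\pi}^\pi(f_0+g_0)^{-1}d\lambda<\infty$, put $C_N^0(e^{i\lambda})=\sum_{j=0}^N((\mathbf B_N^0)^{-1}\mathbf R_N^0\mathbf a_N)_je^{ij\lambda}$, and let the functions $$h_f(f_0,g_0)=\frac{|A_N(e^{i\lambda})g_0(\lambda)+C_N^0(e^{i\lambda})|^2}{(f_0(\lambda)+g_0(\lambda))^2},\qquad h_g(f_0,g_0)=\frac{|A_N(e^{i\lambda})f_0(\lambda)-C_N^0(e^{i\lambda})|^2}{(f_0(\lambda)+g_0(\lambda))^2}$$ be bounded. Suppose that $f_0,g_0$ satisfy the system $$|A_N(e^{i\lambda})g_0(\lambda)+C_N^0(e^{i\lambda})|^2=(f_0(\lambda)+g_0(\lambda))^2(f_0(\lambda)-f_1(\lambda))\alpha_1,$$ $$|A_N(e^{i\lambda})f_0(\lambda)-C_N^0(e^{i\lambda})|^2=(f_0(\lambda)+g_0(\lambda))^2\Psi(\lambda)\alpha_2,$$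 $$\frac1{2\pi}\int_{-\pi}^\pi|f_0-f_1|^2d\lambda=\varepsilon_1,\qquad\frac1{2\pi}\int_{-\pi}^\pi|g_0-g_1|d\lambda=\varepsilon_2,$$ where $\alpha_1,\alpha_2$ are constants, $|\Psi(\lambda)|\le1$ and $\Psi(\lambda)=\operatorname{sign}(g_0(\lambda)-g_1(\lambda))$ where $g_0(\lambda)\ne g_1(\lambda)$; and suppose that $(f_0,g_0)$ determines a solution to the optimization problem $$\max_{(f,g)\in D}\left(\langle\mathbf R_N\mathbf a_N,\mathbf B_N^{-1}\mathbf R_N\mathbf a_N\rangle+\langle\mathbf Q_N\mathbf a_N,\mathbf a_N\rangle\right)=\langle\mathbf R_N^0\mathbf a_N,(\mathbf B_N^0)^{-1}\mathbf R_N^0\mathbf a_N\rangle+\langle\mathbf Q_N^0\mathbf a_N,\mathbf a_N\rangle .$$ Then $f_0,g_0$ are least favourable in $D_{2\varepsilon_1}\times D_{1\varepsilon_2}$ for the optimal linear estimation of $A_N\xi=\sum_{j=0}^Na(j)\xi(j)$ from observations of $\xi(j)+\eta(j)$, $j\in\mathbb Z\setminus\{0,\dots,N\}$, and $$h^0(e^{i\lambda})=\frac{A_N(e^{i\lambda})f_0(\lambda)-C_N^0(e^{i\lambda})}{f_0(\lambda)+g_0(\lambda)}$$ is the minimax-robust spectral characteristic of the optimal linear estimate of $A_N\xi$.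
   Context: $\xi,\eta$ are zero mean uncorrelated wide sense stationary sequences with spectral densities $f,g$ ($E\xi(j+k)\overline{\xi(j)}=\frac1{2\pi}\int e^{ik\lambda}f\,d\lambda$, etc.). $A_N(e^{i\lambda})=\sum_{j=0}^Na(j)e^{ij\lambda}$, $\langle x,y\rangle=\sum_{k=0}^Nx_k\overline{y_k}$. $\mathbf B_N,\mathbf R_N,\mathbf Q_N$ are the $(N+1)\times(N+1)$ matrices with entries $\frac1{2\pi}\int_{-\pi}^\pi e^{-i(j-k)\lambda}\psi(\lambda)d\lambda$, $j,k=0,\dots,N$, with $\psi=\frac1{f+g}$, $\frac f{f+g}$, $\frac{fg}{f+g}$ respectively; superscript $0$ refers to $(f_0,g_0)$. Wherever $\mathbf B_N^{-1}$ is used, $(f,g)$ is understood to satisfy the minimality condition $\int(f+g)^{-1}d\lambda<\infty$. $L_2^N(f+g)$ is the closed span of $\{e^{ij\lambda}:j\in\mathbb Z\setminus\{0,\dots,N\}\}$ in $L_2(f+g)$; for $h\in L_2^N(f+g)$, $\Delta(h;f,g)=\frac1{2\pi}\int|A_N-h|^2f\,d\lambda+\frac1{2\pi}\int|h|^2g\,d\lambda$, and $h(f,g)$ is its minimizer. $(f_0,g_0)\in D$ is least favourable if $\Delta(h(f_0,g_0);f_0,g_0)=\max_{(f,g)\in D}\Delta(h(f,g);f,g)$. $h^0$ is minimax-robust if $h^0\in H_D=\bigcap_{(f,g)\in D}L_2^N(f+g)$ and $\min_{h\in H_D}\max_{(f,g)\in D}\Delta(h;f,g)=\sup_{(f,g)\in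 D}\Delta(h^0;f,g)$. *)

(* Defs.v *)
(* Setting: MathComp-Analysis over an arbitrary R : realType, with complex
   scalars R[i] from mathcomp-real-closed. *)
From HB Require Import structures.
From mathcomp Require Import all_boot all_order all_algebra.
From mathcomp Require Import all_classical all_reals all_analysis.
From mathcomp Require Import complex.

Set Implicit Arguments.
Unset Strict Implicit.
Unset Printing Implicit Defensive.

Import Order.TTheory GRing.Theory Num.Theory.
Import numFieldNormedType.Exports.

Local Open Scope classical_set_scope.
Local Open Scope ring_scope.
Local Open Scope complex_scope.

Definition is_maximum (d : Order.disp_t) (T : porderType d) (S : set T) (m : T)
  : Prop := S m /\ ubound S m.

Definition is_minimum (d : Order.disp_t) (T : porderType d) (S : set T) (m : T)
  : Prop := S m /\ lbound S m.

Section interpolation.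
Context {R : realType}.
Implicit Types (f g w : R -> R) (h p : R -> R[i]).

Definition circle : set R := `[- pi, pi].

(* Densities and spectral characteristics are classes of functions modulo null
   sets, so pointwise conditions are imposed almost everywhere. *)
Definition ae_circle (P : R -> Prop) : Prop :=
  \forall x \ae (@lebesgue_measure R), circle x -> P x.

Definition ae_bounded (u : R -> R) : Prop :=
  exists M : R, ae_circle (fun x => `|u x| <= M).

(* Applied to nonnegative integrands only, where the value may be +oo. *)
Definition emean (u : R -> R) : \bar R :=
  (((2 * pi)^-1)%:E * \int[lebesgue_measure]_(x in circle) (u x)%:E)%E.

Definition cmean (u : R -> R[i]) : R[i] :=
  ((2 * pi)^-1)%:C *
  Complex (\int[lebesgue_measure]_(x in circle) complex.Re (u x))
          (\int[lebesgue_measure]_(x in circle) complex.Im (u x)).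

Definition sqmod (z : R[i]) : R := Normc.normc z ^+ 2.

(* e^(i j x) *)
Definition expi (j : int) (x : R) : R[i] :=
  Complex (cos (j%:~R * x)) (sin (j%:~R * x)).

Definition spectral_density f : Prop :=
  [/\ measurable_fun circle f,
      (forall x, circle x -> 0 <= f x) &
      lebesgue_measure.-integrable circle (EFin \o f)].

(* The inverse is the one of \bar R, for which 0^-1 = +oo; hence minimality
   forces f + g > 0 almost everywhere. *)
Definition minimality f g : Prop :=
  (\int[lebesgue_measure]_(x in circle) ((f x + g x)%:E)^-1 < +oo)%E.

Section fixed_N.
Variable N : nat.
Implicit Types a c : 'cV[R[i]]_N.+1.

Definition trigpoly a (x : R) : R[i] := \sum_(j < N.+1) a j 0 * expi j%:Z x.

Definition dotc (x y : 'cV[R[i]]_N.+1) : R[i] :=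
  \sum_(k < N.+1) x k 0 * (y k 0)^*.

Definition toeplitz (psi : R -> R) : 'M[R[i]]_N.+1 :=
  \matrix_(j, k) cmean (fun x => expi (- (j%:Z - k%:Z)) x * (psi x)%:C).

Definition Bmx f g : 'M[R[i]]_N.+1 := toeplitz (fun x => (f x + g x)^-1).
Definition Rmx f g : 'M[R[i]]_N.+1 := toeplitz (fun x => f x / (f x + g x)).
Definition Qmx f g : 'M[R[i]]_N.+1 :=
  toeplitz (fun x => f x * g x / (f x + g x)).

Definition observed (j : int) : bool := ~~ ((0 <= j) && (j <= N%:Z)).

Definition observed_span : set (R -> R[i]) :=
  [set p | exists (s : seq int) (c : int -> R[i]),
     all observed s /\ p = (fun x => \sum_(j <- s) c j * expi j x)].

(* The closed span of the e^(i j x), j observed, in L_2(w). *)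
Definition L2N w : set (R -> R[i]) :=
  [set h : R -> R[i] | [/\ measurable_fun circle (fun x => complex.Re (h x)),
               measurable_fun circle (fun x => complex.Im (h x)),
               (emean (fun x => sqmod (h x) * w x)%R < +oo)%E &
               forall e : R, 0 < e -> exists2 p, observed_span p &
                 (emean (fun x => sqmod (h x - p x) * w x)%R < e%:E)%E]].

Definition Delta a h f g : \bar R :=
  (emean (fun x => sqmod (trigpoly a x - h x) * f x)%R
   + emean (fun x => sqmod (h x) * g x)%R)%E.

(* h is (a representative of) the spectral characteristic h(f, g). *)
Definition spectral_characteristic a f g h : Prop :=
  L2N (f \+ g) h /\
  forall h', L2N (f \+ g) h' -> (Delta a h f g <= Delta a h' f g)%E.

Definition least_favourable a (D : set ((R -> R) * (R -> R))) f0 g0 : Prop :=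
  D (f0, g0) /\
  exists2 h0, spectral_characteristic a f0 g0 h0 &
    is_maximum
      [set d | exists f g h, [/\ D (f, g), spectral_characteristic a f g h &
                                 d = Delta a h f g]]
      (Delta a h0 f0 g0).

Definition admissible (D : set ((R -> R) * (R -> R))) : set (R -> R[i]) :=
  \bigcap_(fg in D) L2N (fg.1 \+ fg.2).

Definition worst_error a (D : set ((R -> R) * (R -> R))) h : \bar R :=
  ereal_sup [set Delta a h fg.1 fg.2 | fg in D].

Definition minimax_robust a (D : set ((R -> R) * (R -> R))) h0 : Prop :=
  admissible D h0 /\
  is_minimum [set worst_error a D h | h in admissible D] (worst_error a D h0).

(* Complex-valued as written; its values are real, so that the order of R[i],
   which compares numbers with equal imaginary parts, is the usual one. *)
Definition error_functional a f g : R[i] :=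
  dotc (Rmx f g *m a) (invmx (Bmx f g) *m (Rmx f g *m a))
  + dotc (Qmx f g *m a) a.

Definition solves_optimization a (D : set ((R -> R) * (R -> R))) f0 g0 : Prop :=
  is_maximum
    [set error_functional a fg.1 fg.2 | fg in
       D `&` [set fg | minimality fg.1 fg.2]]
    (error_functional a f0 g0).

Definition Cpoly a f g : R -> R[i] :=
  trigpoly (invmx (Bmx f g) *m (Rmx f g *m a)).

Definition hnum_f a f g (x : R) : R :=
  sqmod (trigpoly a x * (g x)%:C + Cpoly a f g x).

Definition hnum_g a f g (x : R) : R :=
  sqmod (trigpoly a x * (f x)%:C - Cpoly a f g x).

Definition hfun_f a f g (x : R) : R := hnum_f a f g x / (f x + g x) ^+ 2.

Definition hfun_g a f g (x : R) : R := hnum_g a f g x / (f x + g x) ^+ 2.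

Definition hopt a f g (x : R) : R[i] :=
  (trigpoly a x * (f x)%:C - Cpoly a f g x) / (f x + g x)%:C.

End fixed_N.

Definition D2 (eps1 : R) f1 : set (R -> R) :=
  [set f | spectral_density f /\
           (emean (fun x => `|f x - f1 x| ^+ 2)%R <= eps1%:E)%E].

Definition D1 (eps2 : R) g1 : set (R -> R) :=
  [set g | spectral_density g /\
           (emean (fun x => `|g x - g1 x|)%R <= eps2%:E)%E].

End interpolation.

(* Main.v *)
(** Write A for the polynomial of a, C for C_N^0 and h0 for h(f0, g0), so that
    h0 = (A f0 - C) / (f0 + g0).  The normal equations B c = R a say that the
    Fourier coefficients of h0 of index 0, ..., N vanish; as h0 is bounded, it
    then lies in the observed span of L_2(f + g) for every pair of densities
    (trigonometric polynomials are dense in L_2((f + g + 1) dx), and correcting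
    the coefficients 0, ..., N of an approximant costs little).  Completing the
    square shows that h0 minimizes the error for (f0, g0).

    It remains to see that (f, g) |-> Delta(h0; f, g), which is linear, is
    maximal over D at (f0, g0).  By the system this functional is
    mean (alpha1 (f0 - f1) f + alpha2 Psi g), and for alpha1, alpha2 >= 0 the
    claim is 2 v (u - v) <= u^2 - v^2 with u = f - f1, v = f0 - f1,
    respectively Psi (g - g0) <= |g - g1| - |g0 - g1|.  The signs come from the
    optimization problem: if alpha1 < 0 then f0 <= f1, and replacing f0 by its
    reflection 2 f1 - f0 stays in D but strictly increases the error; similarly
    for alpha2. *)

Require Import Defs.
From HB Require Import structures.
From mathcomp Require Import all_boot all_order all_algebra.
From mathcomp Require Import all_classical all_reals all_analysis.
From mathcomp Require Import measurable_realfun complex.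
From mathcomp Require Import ring lra.

Set Implicit Arguments.
Unset Strict Implicit.
Unset Printing Implicit Defensive.

Import Order.TTheory GRing.Theory Num.Theory.
Import numFieldNormedType.Exports.

Local Open Scope classical_set_scope.
Local Open Scope ring_scope.
Local Open Scope complex_scope.

(** * Means over the circle *)

Section mean_calculus.
Context {R : realType}.
Implicit Types u v w : R -> R.
Notation mu := (@lebesgue_measure R).

(** The error involves the inverse of [Bmx], which makes two pairs hard to compare directly. For a
    fixed coefficient vector [c] the mean of the explicit function [dual_density] never exceeds the
    error, and equals it when [c] is the vector of C for that pair. With [c] frozen at the vector
    for (f0, g0), raising f or g changes this mean by an exact pointwise formula, so the signs of
    the multipliers come from finite increments and nothing is differentiated. Densities are only
    ever raised, which also preserves minimality; this is why the reflection acts only at points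
    where f0 < f1.

    The characteristic h0 must lie in the observed span for every pair in D, where f + g is merely
    integrable. Density of trigonometric polynomials is therefore proved for an arbitrary integrable
    weight: powers of a trigonometric polynomial separate an arc from its complement, Dynkin's
    theorem passes to Borel sets, and binary expansions pass to bounded functions. *)

Definition rint u : Prop := mu.-integrable circle (EFin \o u).

Definition rmean u : R := (2 * pi)^-1 * \int[mu]_(x in circle) u x.

Lemma measurable_circle : measurable (circle : set (g_sigma_algebraType (R.-ocitv.-measurable))).
Proof. exact: measurable_itv. Qed.
#[local] Hint Extern 0 (measurable circle) => exact: measurable_itv : core.

Lemma twopi_gt0 : 0 < 2 * pi :> R.
Proof. by rewrite mulr_gt0 ?pi_gt0. Qed.

Lemma lebesgue_measure_circle : mu circle = (2 * pi)%:E.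
Proof.
rewrite /circle lebesgue_measure_itv /= lte_fin.
rewrite (lt_trans _ (pi_gt0 R)) ?oppr_lt0 ?pi_gt0 //.
by rewrite -EFinB opprK mulr2n mulrDl !mul1r.
Qed.

Lemma measurable_fun_invr (D : set R) u :
  measurable D -> measurable_fun D u -> (forall x, D x -> 0 <= u x) ->
  measurable_fun D (fun x => (u x)^-1).
Proof.
(* On nonnegative reals inversion, with 0^-1 = 0, is the power of exponent -1, so its discontinuity
   at 0 is harmless. *)
move=> mD mu0 u0; apply: (@eq_measurable_fun _ _ _ _ _ (fun x => u x `^ (-1))).
  by move=> x /set_mem Dx; rewrite powR_inv1 ?u0.
by apply: (@measurableT_comp _ _ _ _ _ _ (fun y : R => y `^ (-1)) _ u) => //;
  exact: measurable_powR.
Qed.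

Lemma rint_measurable u : rint u -> measurable_fun circle u.
Proof. by move=> /integrableP[/measurable_EFinP]. Qed.

Lemma ae_circleW (P : R -> Prop) : (forall x, circle x -> P x) -> ae_circle P.
Proof. by move=> H; apply: aeW. Qed.

Lemma ae_circleS (P Q : R -> Prop) :
  (forall x, circle x -> P x -> Q x) -> ae_circle P -> ae_circle Q.
Proof.
by move=> H; rewrite /ae_circle => HP;
  apply: (@filterS _ _ (ae_filter_ringOfSetsType mu) _ _ _ HP)
  => x Px cx; apply: H (Px cx).
Qed.

Lemma ae_circleS2 (P Q S : R -> Prop) :
  (forall x, circle x -> P x -> Q x -> S x) ->
  ae_circle P -> ae_circle Q -> ae_circle S.
Proof.
move=> H; rewrite /ae_circle => HP HQ.
apply: (@filterS2 _ _ (ae_filter_ringOfSetsType mu) _ _ _ _ HP HQ) => x Px Qx cx.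
exact: H (Px cx) (Qx cx).
Qed.

Lemma ae_circleS3 (P Q S T : R -> Prop) :
  (forall x, circle x -> P x -> Q x -> S x -> T x) ->
  ae_circle P -> ae_circle Q -> ae_circle S -> ae_circle T.
Proof.
move=> H; rewrite /ae_circle => HP HQ HS.
apply: (@filterS3 _ _ (ae_filter_ringOfSetsType mu) _ _ _ _ _ HP HQ HS) => x Px Qx Sx cx.
exact: H (Px cx) (Qx cx) (Sx cx).
Qed.

Lemma rint_le u v : measurable_fun circle u ->
  ae_circle (fun x => `|u x| <= v x) -> rint v -> rint u.
Proof.
move=> mu0 uv iv; apply/integrableP; split; first exact/measurable_EFinP.
have /integrableP[mv fv] := iv.
apply: le_lt_trans fv; apply: ae_ge0_le_integral => //.
- by do 2! apply: measurableT_comp => //.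
- by apply: measurableT_comp.
- apply: ae_circleS uv => x cx uvx; rewrite /= lee_fin.
  exact: le_trans uvx (ler_norm _).
Qed.

Lemma rint_bounded u (M : R) : measurable_fun circle u ->
  ae_circle (fun x => `|u x| <= M) -> rint u.
Proof.
move=> mu0 uM; apply: (@rint_le _ (cst M)) => //.
apply: measurable_bounded_integrable => //.
  by move: (ltry (2 * pi : R)); rewrite -lebesgue_measure_circle.
by exists `|M|; split => // x Mx y _; apply: ltW.
Qed.

Lemma rint_cst (k : R) : rint (cst k).
Proof. by apply: (@rint_bounded _ `|k|) => //; apply: ae_circleW. Qed.

Lemma rintD u v : rint u -> rint v -> rint (fun x => u x + v x).
Proof. by move=> iu iv; have := integrableD measurable_circle iu iv. Qed.

Lemma rintZ (k : R) u : rint u -> rint (fun x => k * u x).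
Proof. by move=> iu; have := integrableZl measurable_circle k iu. Qed.

Lemma rintN u : rint u -> rint (fun x => - u x).
Proof. by move=> iu; have := integrableN iu. Qed.

Lemma rintB u v : rint u -> rint v -> rint (fun x => u x - v x).
Proof. by move=> iu iv; apply: rintD => //; exact: rintN. Qed.

Lemma rint_norm u : rint u -> rint (fun x => `|u x|).
Proof. by move=> iu; exact: integrable_norm. Qed.

Lemma rint_mul_bounded u v (M : R) : measurable_fun circle u ->
  ae_circle (fun x => `|u x| <= M) -> rint v -> rint (fun x => u x * v x).
Proof.
move=> mu0 uM iv; apply: (@rint_le _ (fun x => M * `|v x|)).
- by apply: measurable_funM => //; exact: rint_measurable.
- apply: ae_circleS uM => x _ uMx.
  by rewrite normrM ler_wpM2r.
- by apply: rintZ; exact: rint_norm.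
Qed.

Lemma rmeanD u v : rint u -> rint v ->
  rmean (fun x => u x + v x) = rmean u + rmean v.
Proof. by move=> iu iv; rewrite /rmean RintegralD // mulrDr. Qed.

Lemma rmeanZ (k : R) u : rint u -> rmean (fun x => k * u x) = k * rmean u.
Proof. by move=> iu; rewrite /rmean RintegralZl // mulrCA. Qed.

Lemma rmeanB u v : rint u -> rint v ->
  rmean (fun x => u x - v x) = rmean u - rmean v.
Proof. by move=> iu iv; rewrite /rmean RintegralB // mulrBr. Qed.

Lemma rmeanN u : rint u -> rmean (fun x => - u x) = - rmean u.
Proof.
move=> iu; rewrite -[RHS]mulN1r -rmeanZ //; congr (_ * _).
by apply: eq_Rintegral => x _; rewrite mulN1r.
Qed.

Lemma eq_rmean u v : {in circle, u =1 v} -> rmean u = rmean v.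
Proof. by move=> uv; congr (_ * _); exact: eq_Rintegral. Qed.

Lemma rmean_cst (k : R) : rmean (cst k) = k.
Proof.
have mc : fine (mu circle) = 2 * pi by rewrite lebesgue_measure_circle.
rewrite /rmean Rintegral_cst // [X in _ * (_ * X)]mc mulrCA mulVf ?mulr1 //.
by rewrite gt_eqF // twopi_gt0.
Qed.

Lemma rmean_ge0 u : rint u -> ae_circle (fun x => 0 <= u x) -> 0 <= rmean u.
Proof.
move=> iu u0; rewrite /rmean mulr_ge0 ?invr_ge0 ?(ltW twopi_gt0) //.
have mu0 : measurable_fun circle (EFin \o u) by case/integrableP : iu.
(* The sign is known only almost everywhere, so [u] is first replaced by its absolute value. *)
have -> : \int[mu]_(x in circle) u x = \int[mu]_(x in circle) `|u x|.
  rewrite /Rintegral; congr fine; apply: ae_eq_integral => //.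
    by apply/measurable_EFinP; apply: measurableT_comp => //; exact: rint_measurable.
  by apply: ae_circleS u0 => x cx ux /=; rewrite ger0_norm.
by apply: Rintegral_ge0.
Qed.

Lemma le_rmean u v : rint u -> rint v -> ae_circle (fun x => u x <= v x) ->
  rmean u <= rmean v.
Proof.
move=> iu iv uv; rewrite -subr_ge0 -rmeanB //; apply: rmean_ge0.
  exact: rintB.
by apply: ae_circleS uv => x _; rewrite subr_ge0.
Qed.

Lemma ae_eq_rmean u v : rint u -> rint v -> ae_circle (fun x => u x = v x) ->
  rmean u = rmean v.
Proof.
by move=> iu iv uv; apply/eqP; rewrite eq_le !le_rmean //;
  apply: ae_circleS uv => x _ ->.
Qed.

(** The equality case of [rmean_ge0]. It drives both strictness arguments: definiteness of the
    Toeplitz forms and the vanishing of increments at an optimal pair. *)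
Lemma rmean_le0_ae u : rint u -> ae_circle (fun x => 0 <= u x) ->
  rmean u <= 0 -> ae_circle (fun x => u x = 0).
Proof.
move=> iu u0 mle.
have mu0 : measurable_fun circle (EFin \o u) by case/integrableP : iu.
have r0 : rmean u = 0 by apply/eqP; rewrite eq_le mle rmean_ge0.
have E : (\int[mu]_(x in circle) `|(u x)%:E|)%E = (\int[mu]_(x in circle) (u x)%:E)%E.
  apply: ae_eq_integral => //.
    exact: measurableT_comp.
  by apply: ae_circleS u0 => x cx ux /=; rewrite ger0_norm.
suff /ae_eq_integral_abs : (\int[mu]_(x in circle) `|(EFin \o u) x| = 0)%E.
  by move=> /(_ measurable_circle mu0); apply: ae_circleS => x cx [].
rewrite /= E -(fineK (integrable_fin_num measurable_circle iu)).
move/eqP : r0; rewrite /rmean mulf_eq0 invr_eq0 gt_eqF ?twopi_gt0 //= => /eqP.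
by rewrite /Rintegral => ->.
Qed.

(** Passage from the extended means of the statement to real ones, which can be subtracted. *)
Lemma emean_rmean u : rint u -> emean u = (rmean u)%:E.
Proof.
move=> iu; rewrite /emean /rmean EFinM; congr (_ * _)%E.
by rewrite /Rintegral fineK //; exact: integrable_fin_num.
Qed.

Lemma rint_emean u : measurable_fun circle u ->
  (forall x, circle x -> 0 <= u x) -> (emean u < +oo)%E -> rint u.
Proof.
move=> mu0 u0 fu; apply/integrableP; split; first exact/measurable_EFinP.
have -> : (\int[mu]_(x in circle) `|(EFin \o u) x| =
           \int[mu]_(x in circle) (u x)%:E)%E.
  by apply: eq_integral => x /set_mem cx; rewrite /= ger0_norm // u0.
have I0 : (0 <= \int[mu]_(x in circle) (u x)%:E)%E.
  by apply: integral_ge0 => x cx; rewrite lee_fin u0.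
rewrite ltey; apply/eqP => Ioo; move: fu.
by rewrite /emean Ioo gt0_muley ?ltxx // lte_fin invr_gt0 twopi_gt0.
Qed.

End mean_calculus.
#[global] Hint Extern 0 (measurable circle) => exact: measurable_itv : core.

(** * Real and imaginary parts, squared modulus *)

Section complex_parts.
Context {R : realType}.
Implicit Types z w : R[i].

Lemma Re_add z w : complex.Re (z + w) = complex.Re z + complex.Re w.
Proof. by case: z w => [a b] [c d]. Qed.
Lemma Im_add z w : complex.Im (z + w) = complex.Im z + complex.Im w.
Proof. by case: z w => [a b] [c d]. Qed.
Lemma Re_opp z : complex.Re (- z) = - complex.Re z.
Proof. by case: z. Qed.
Lemma Im_opp z : complex.Im (- z) = - complex.Im z.
Proof. by case: z. Qed.
Lemma Re_mul z w : complex.Re (z * w) =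
  complex.Re z * complex.Re w - complex.Im z * complex.Im w.
Proof. by case: z w => [a b] [c d]. Qed.
Lemma Im_mul z w : complex.Im (z * w) =
  complex.Re z * complex.Im w + complex.Im z * complex.Re w.
Proof. by case: z w => [a b] [c d]. Qed.
Lemma Re_conj z : complex.Re (conjc z) = complex.Re z.
Proof. by case: z. Qed.
Lemma Im_conj z : complex.Im (conjc z) = - complex.Im z.
Proof. by case: z. Qed.
Lemma Re_divr z (p : R) : complex.Re (z / p%:C) = complex.Re z / p.
Proof. by rewrite -fmorphV /=; case: z => a b /=; rewrite mulr0 subr0. Qed.
Lemma Im_divr z (p : R) : complex.Im (z / p%:C) = complex.Im z / p.
Proof. by rewrite -fmorphV /=; case: z => a b /=; rewrite mulr0 add0r. Qed.

Definition ReImE := (Re_divr, Im_divr, Re_add, Im_add, Re_opp, Im_opp,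
  Re_mul, Im_mul, Re_conj, Im_conj).

Lemma complex_ext z w : complex.Re z = complex.Re w ->
  complex.Im z = complex.Im w -> z = w.
Proof. by case: z w => [a b] [c d] /= -> ->. Qed.

Lemma sqmodE z : sqmod z = complex.Re z ^+ 2 + complex.Im z ^+ 2.
Proof. by case: z => a b; rewrite /sqmod /= sqr_sqrtr ?addr_ge0 ?sqr_ge0. Qed.

Lemma sqmod_ge0 z : 0 <= sqmod z.
Proof. by rewrite sqmodE addr_ge0 ?sqr_ge0. Qed.

Lemma sqmodM z w : sqmod (z * w) = sqmod z * sqmod w.
Proof. by rewrite !sqmodE !ReImE; ring. Qed.

Lemma sqmodN z : sqmod (- z) = sqmod z.
Proof. by rewrite !sqmodE !ReImE !sqrrN. Qed.

Lemma sqmod_real (r : R) : sqmod r%:C = r ^+ 2.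
Proof. by rewrite sqmodE /= expr0n addr0. Qed.

Lemma sqmod_divr z (p : R) : sqmod (z / p%:C) = sqmod z / p ^+ 2.
Proof. by rewrite !sqmodE !ReImE !exprMn exprVn mulrDl. Qed.

Lemma sqmod_eq0 z : sqmod z = 0 -> z = 0.
Proof.
rewrite sqmodE => /eqP; rewrite paddr_eq0 ?sqr_ge0 // !sqrf_eq0.
by case: z => a b /= /andP[/eqP -> /eqP ->].
Qed.

(** By the parallelogram identity the defect is [sqmod (z - w)]. This is the triangle inequality for
    squared norms, and the source of the factors 2 and 4 in the estimates below. *)
Lemma sqmodD_le z w : sqmod (z + w) <= 2 * sqmod z + 2 * sqmod w.
Proof.
rewrite !sqmodE !ReImE -subr_ge0.
set a := complex.Re z; set b := complex.Im z; set c := complex.Re w; set d := complex.Im w.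
have -> : 2 * (a ^+ 2 + b ^+ 2) + 2 * (c ^+ 2 + d ^+ 2)
  - ((a + c) ^+ 2 + (b + d) ^+ 2) = (a - c) ^+ 2 + (b - d) ^+ 2 by ring.
by rewrite addr_ge0 ?sqr_ge0.
Qed.

Lemma norm_Re_le z : `|complex.Re z| <= Num.sqrt (sqmod z).
Proof. by rewrite -sqrtr_sqr ler_wsqrtr // sqmodE lerDl sqr_ge0. Qed.

Lemma norm_Im_le z : `|complex.Im z| <= Num.sqrt (sqmod z).
Proof. by rewrite -sqrtr_sqr ler_wsqrtr // sqmodE lerDr sqr_ge0. Qed.

Lemma Re_sum I (r : seq I) (P : pred I) (F : I -> R[i]) :
  complex.Re (\sum_(i <- r | P i) F i) = \sum_(i <- r | P i) complex.Re (F i).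
Proof. by apply: (big_morph _ Re_add). Qed.

Lemma conjcD z w : conjc (z + w) = conjc z + conjc w.
Proof. by apply: complex_ext; rewrite !ReImE //; ring. Qed.

Lemma conjcM z w : conjc (z * w) = conjc z * conjc w.
Proof. by apply: complex_ext; rewrite !ReImE; ring. Qed.

Lemma conjc_sum I (r : seq I) (P : pred I) (F : I -> R[i]) :
  conjc (\sum_(i <- r | P i) F i) = \sum_(i <- r | P i) conjc (F i).
Proof. by apply: (big_morph _ conjcD); rewrite conjc0. Qed.

End complex_parts.

(** * Means of complex functions *)

Section complex_mean.
Context {R : realType}.
Implicit Types (u v : R -> R[i]) (c : R[i]).

Definition cmeasurable u : Prop :=
  measurable_fun circle (fun x => complex.Re (u x)) /\
  measurable_fun circle (fun x => complex.Im (u x)).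

Definition cint u : Prop :=
  rint (fun x => complex.Re (u x)) /\ rint (fun x => complex.Im (u x)).

Lemma cmeasurableD u v : cmeasurable u -> cmeasurable v ->
  cmeasurable (fun x => u x + v x).
Proof.
move=> [ur ui] [vr vi]; split.
  by under eq_fun do rewrite Re_add; exact: measurable_funD.
by under eq_fun do rewrite Im_add; exact: measurable_funD.
Qed.

Lemma cmeasurableN u : cmeasurable u -> cmeasurable (fun x => - u x).
Proof.
move=> [ur ui]; split.
  by under eq_fun do rewrite Re_opp; exact: measurable_funN.
by under eq_fun do rewrite Im_opp; exact: measurable_funN.
Qed.

Lemma cmeasurableB u v : cmeasurable u -> cmeasurable v ->
  cmeasurable (fun x => u x - v x).
Proof. by move=> mu mv; apply: cmeasurableD => //; exact: cmeasurableN. Qed.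

Lemma cmeasurableM u v : cmeasurable u -> cmeasurable v ->
  cmeasurable (fun x => u x * v x).
Proof.
move=> [ur ui] [vr vi]; split.
  by under eq_fun do rewrite Re_mul; apply: measurable_funB; exact: measurable_funM.
by under eq_fun do rewrite Im_mul; apply: measurable_funD; exact: measurable_funM.
Qed.

Lemma cmeasurable_real (r : R -> R) : measurable_fun circle r ->
  cmeasurable (fun x => (r x)%:C).
Proof. by move=> mr; split => //=; exact: measurable_cst. Qed.

Lemma cmeasurable_divr u (r : R -> R) : cmeasurable u ->
  measurable_fun circle r -> (forall x, circle x -> 0 <= r x) ->
  cmeasurable (fun x => u x / (r x)%:C).
Proof.
move=> [ur ui] mr r0; split.
  by under eq_fun do rewrite Re_divr; apply: measurable_funM => //; exact: measurable_fun_invr.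
by under eq_fun do rewrite Im_divr; apply: measurable_funM => //; exact: measurable_fun_invr.
Qed.

Lemma cmeasurable_cst c : cmeasurable (cst c).
Proof. by split; exact: measurable_cst. Qed.

Lemma cmeasurable_sum I (r : seq I) (F : I -> R -> R[i]) :
  (forall i, cmeasurable (F i)) -> cmeasurable (fun x => \sum_(i <- r) F i x).
Proof.
move=> mF; elim: r => [|i r IH].
  by under eq_fun do rewrite big_nil; exact: cmeasurable_cst.
by under eq_fun do rewrite big_cons; exact: cmeasurableD.
Qed.

Lemma measurable_sqmod u : cmeasurable u ->
  measurable_fun circle (fun x => sqmod (u x)).
Proof.
move=> [ur ui]; under eq_fun do rewrite sqmodE.
by apply: measurable_funD; exact: measurable_funX.
Qed.

Lemma cintD u v : cint u -> cint v -> cint (fun x => u x + v x).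
Proof.
move=> [ur ui] [vr vi]; split.
  by under eq_fun do rewrite Re_add; exact: rintD.
by under eq_fun do rewrite Im_add; exact: rintD.
Qed.

Lemma cintZ c u : cint u -> cint (fun x => c * u x).
Proof.
move=> [ur ui]; split.
  by under eq_fun do rewrite Re_mul; apply: rintB; exact: rintZ.
by under eq_fun do rewrite Im_mul; apply: rintD; exact: rintZ.
Qed.

Lemma cint0 : cint (cst 0).
Proof. by split; exact: rint_cst. Qed.

Lemma cint_mul_bounded u (r : R -> R) (M : R) : cmeasurable u ->
  ae_circle (fun x => sqmod (u x) <= M) -> rint r ->
  cint (fun x => u x * (r x)%:C).
Proof.
move=> [ur ui] uM ir; split.
  under eq_fun do rewrite Re_mul /= mulr0 subr0.
  apply: (@rint_mul_bounded _ _ _ (Num.sqrt M)) => //.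
  apply: ae_circleS uM => x _ uMx.
  by apply: le_trans (norm_Re_le _) _; rewrite ler_wsqrtr.
under eq_fun do rewrite Im_mul /= mulr0 add0r.
apply: (@rint_mul_bounded _ _ _ (Num.sqrt M)) => //.
apply: ae_circleS uM => x _ uMx.
by apply: le_trans (norm_Im_le _) _; rewrite ler_wsqrtr.
Qed.

Lemma cint_sum I (r : seq I) (F : I -> R -> R[i]) :
  (forall i, cint (F i)) -> cint (fun x => \sum_(i <- r) F i x).
Proof.
move=> mF; elim: r => [|i r IH].
  by under eq_fun do rewrite big_nil; exact: cint0.
by under eq_fun do rewrite big_cons; exact: cintD.
Qed.

Lemma cmeanE u : cmean u = Complex (rmean (fun x => complex.Re (u x)))
                                   (rmean (fun x => complex.Im (u x))).
Proof. by apply: complex_ext; rewrite /cmean !ReImE /= mul0r ?subr0 ?addr0. Qed.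

Lemma eq_cmean u v : {in circle, u =1 v} -> cmean u = cmean v.
Proof.
by move=> uv; rewrite !cmeanE; congr (Complex _ _); apply: eq_rmean => x cx /=;
  rewrite uv.
Qed.

Lemma cmeanD u v : cint u -> cint v ->
  cmean (fun x => u x + v x) = cmean u + cmean v.
Proof.
move=> [ur ui] [vr vi]; rewrite !cmeanE; apply: complex_ext => /=; rewrite -rmeanD //;
  by apply: eq_rmean => x _; rewrite !ReImE.
Qed.

Lemma cmeanZ c u : cint u -> cmean (fun x => c * u x) = c * cmean u.
Proof.
move=> [ur ui]; rewrite !cmeanE; apply: complex_ext; rewrite !ReImE /= -!rmeanZ //.
  rewrite -rmeanB; [|exact: rintZ|exact: rintZ].
  by apply: eq_rmean => x _; rewrite !ReImE.
rewrite -rmeanD; [|exact: rintZ|exact: rintZ].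
by apply: eq_rmean => x _; rewrite !ReImE.
Qed.

Lemma cmean_sum I (r : seq I) (F : I -> R -> R[i]) :
  (forall i, cint (F i)) ->
  cmean (fun x => \sum_(i <- r) F i x) = \sum_(i <- r) cmean (F i).
Proof.
move=> mF; elim: r => [|i r IH].
  rewrite big_nil cmeanE; apply: complex_ext => /=; rewrite -[RHS](rmean_cst (0 : R));
  by apply: eq_rmean => x _ /=; rewrite big_nil.
rewrite big_cons -IH -cmeanD //; last exact: cint_sum.
by apply: eq_cmean => x _; rewrite big_cons.
Qed.

End complex_mean.

(** * Exponentials and their means *)

Section exponentials.
Context {R : realType}.
Implicit Types (j k : int) (x : R).

Lemma rmean_derive (F f : R -> R) :
  (forall x, is_derive x 1 F (f x)) -> continuous f ->
  rmean f = (2 * pi)^-1 * (F pi - F (- pi)).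
Proof.
move=> dF cf; congr (_ * _); rewrite /Rintegral.
have cF : continuous F.
  by move=> x; apply: differentiable_continuous; apply/derivable1_diffP; case: (dF x).
rewrite (@continuous_FTC2 R f F) //.
- by rewrite (lt_trans _ (pi_gt0 R)) ?oppr_lt0 ?pi_gt0.
- exact: continuous_subspaceT.
- split; first by move=> x _; case: (dF x).
    by apply: cvg_at_right_filter; exact: cF.
  by apply: cvg_at_left_filter; exact: cF.
- by move=> x _; rewrite derive1E; case: (dF x).
Qed.

Lemma sin_int_pi j : sin (j%:~R * pi) = 0 :> R.
Proof.
have H (n : nat) : sin (n%:R * pi) = 0 :> R.
  by rewrite mulr_natl -[pi *+ n]add0r (alternatingn (@sinDpi R)) sin0 mulr0.
by case: j => n; rewrite ?NegzE ?mulrNz ?mulNr ?sinN H ?oppr0.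
Qed.

Lemma is_derive_scaled (F f : R -> R) (c : R) :
  (forall x, is_derive x 1 F (f x)) ->
  forall x, is_derive x 1 (fun y => F (c * y)) (c * f (c * x)).
Proof.
move=> dF x.
have dc : is_derive x 1 (fun y : R => c * y) c.
  by have := is_deriveZ c (is_derive_id x (1 : R)); rewrite /GRing.scale /= mulr1.
have := @is_derive1_comp R F (fun y : R => c * y) x _ _ (dF _) dc.
by rewrite mulrC.
Qed.

Lemma continuous_scaled (f : R -> R) (c : R) : continuous f ->
  continuous (fun x => f (c * x)).
Proof.
move=> cf x; apply: (@continuous_comp _ _ _ (fun y => c * y) f); last exact: cf.
exact: mulrl_continuous.
Qed.

Lemma rmean_cos j : rmean (fun x => cos (j%:~R * x)) = (j == 0)%:R.
Proof.
have [->|j0] := eqVneq j 0.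
  by rewrite -[RHS]rmean_cst; apply: eq_rmean => x _ /=; rewrite mul0r cos0.
have jn : (j%:~R : R) != 0 by rewrite intr_eq0.
(* Multiplied by j, the integrand is the derivative of sin (j x), which vanishes at both ends. *)
apply: (mulfI jn); rewrite -rmeanZ.
  have cf : continuous (fun x : R => j%:~R * cos (j%:~R * x)).
    move=> x; apply: continuousM; first exact: cst_continuous.
    exact: (continuous_scaled (@continuous_cos R)).
  rewrite (rmean_derive (is_derive_scaled j%:~R (@is_derive_sin R)) cf).
  by rewrite mulrN sinN sin_int_pi oppr0 subrr !mulr0.
apply: (@rint_bounded _ _ 1).
  apply: (@measurable_funS _ _ _ _ setT) => //.
  by apply: continuous_measurable_fun; exact: (continuous_scaled (@continuous_cos R)).
by apply: ae_circleW => x _; exact: cos_max.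
Qed.

Lemma rmean_sin j : rmean (fun x => sin (j%:~R * x)) = 0.
Proof.
have [->|j0] := eqVneq j 0.
  by rewrite -[RHS]rmean_cst; apply: eq_rmean => x _ /=; rewrite mul0r sin0.
have jn : (j%:~R : R) != 0 by rewrite intr_eq0.
have jn' : (- j%:~R : R) != 0 by rewrite oppr_eq0.
(* Multiplied by -j, the integrand is the derivative of cos (j x), which is even, so the end values
   cancel. *)
apply: (mulfI jn'); rewrite -rmeanZ.
  have cf (k : R) : continuous (fun x : R => k * sin (j%:~R * x)).
    move=> x; apply: continuousM; first exact: cst_continuous.
    exact: (continuous_scaled (@continuous_sin R)).
  have dF x : is_derive x 1 (fun y : R => cos (j%:~R * y)) (- j%:~R * sin (j%:~R * x)).
    by have := is_derive_scaled j%:~R (@is_derive_cos R) x; rewrite mulrN mulNr.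
  by rewrite (rmean_derive dF (cf _)) mulrN cosN subrr !mulr0.
apply: (@rint_bounded _ _ 1).
  apply: (@measurable_funS _ _ _ _ setT) => //.
  by apply: continuous_measurable_fun; exact: (continuous_scaled (@continuous_sin R)).
by apply: ae_circleW => x _; exact: sin_max.
Qed.

Lemma cmean_expi j : cmean (@expi R j) = (j == 0)%:R.
Proof.
rewrite cmeanE /= rmean_cos rmean_sin.
by case: eqP.
Qed.

Lemma sqmod_expi j x : sqmod (expi j x) = 1.
Proof. by rewrite sqmodE /= cos2Dsin2. Qed.

Lemma expiD j k x : expi (j + k) x = expi j x * expi k x.
Proof.
by apply: complex_ext; rewrite !ReImE /= intrD mulrDl ?cosD ?sinD // addrC.
Qed.

Lemma expi0 x : expi 0 x = 1.
Proof. by rewrite /expi mul0r cos0 sin0. Qed.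

Lemma conj_expi j x : conjc (expi j x) = expi (- j) x.
Proof. by rewrite /expi /= mulrNz mulNr cosN sinN. Qed.

Lemma cmeasurable_expi j : cmeasurable (@expi R j).
Proof.
split; apply: (@measurable_funS _ _ _ _ setT) => //;
  apply: continuous_measurable_fun.
  exact: (continuous_scaled (@continuous_cos R)).
exact: (continuous_scaled (@continuous_sin R)).
Qed.

Lemma cint_expi_mul j (r : R -> R) : rint r -> cint (fun x => expi j x * (r x)%:C).
Proof.
move=> ir; apply: (@cint_mul_bounded _ _ _ 1) => //; first exact: cmeasurable_expi.
by apply: ae_circleW => x _; rewrite sqmod_expi.
Qed.

Lemma cint_expi j : cint (@expi R j).
Proof.
have := cint_expi_mul j (rint_cst (1 : R)).
by under eq_fun do rewrite mulr1.
Qed.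

End exponentials.

(** * Density of trigonometric polynomials *)

Section trigonometric_sums.
Context {R : realType}.
Implicit Types (u v : R -> R[i]) (w : R -> R) (l : seq (int * R[i])).

(** Pairs of a frequency and a coefficient, repetitions allowed: sums and products of trigonometric
    sums become concatenations and lists of all pairs. *)
Definition trigsum l (x : R) : R[i] := \sum_(q <- l) q.2 * expi q.1 x.

Definition istrig u : Prop := exists l, u = trigsum l.

Lemma istrig_expi c j : istrig (fun x => c * expi j x).
Proof. by exists [:: (j, c)]; apply/funext => x; rewrite /trigsum big_seq1. Qed.

Lemma istrig_cst c : istrig (cst c).
Proof.
have := istrig_expi c 0; congr istrig.
by apply/funext => x; rewrite expi0 mulr1.
Qed.

Lemma istrigD u v : istrig u -> istrig v -> istrig (fun x => u x + v x).
Proof.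
move=> [l ->] [m ->]; exists (l ++ m); apply/funext => x.
by rewrite /trigsum big_cat.
Qed.

Lemma istrigM u v : istrig u -> istrig v -> istrig (fun x => u x * v x).
Proof.
move=> [l ->] [m ->].
exists [seq (p.1 + q.1, p.2 * q.2) | p <- l, q <- m]; apply/funext => x.
rewrite /trigsum big_allpairs_dep /= mulr_suml; apply: eq_bigr => p _.
by rewrite mulr_sumr; apply: eq_bigr => q _; rewrite expiD mulrACA.
Qed.

Lemma istrigX u n : istrig u -> istrig (fun x => u x ^+ n).
Proof.
move=> tu; elim: n => [|n IH]; first exact: istrig_cst.
by under eq_fun do rewrite exprS; exact: istrigM.
Qed.

Lemma istrigJ u : istrig u -> istrig (fun x => conjc (u x)).
Proof.
move=> [l ->]; exists [seq (- q.1, (conjc q.2)) | q <- l]; apply/funext => x.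
rewrite /trigsum big_map; elim: l => [|q l IH]; first by rewrite !big_nil conjc0.
by rewrite !big_cons conjcD conjcM conj_expi IH.
Qed.

Lemma istrig_cosB (x0 : R) : istrig (fun x => (cos (x - x0))%:C).
Proof.
(* [u x] is e^(i (x - x0)), and the cosine is half the sum of [u] and its conjugate. *)
pose u x := Complex (cos x0) (- sin x0) * @expi R 1 x.
have tu : istrig u by exact: istrig_expi.
have := istrigM (istrig_cst (2^-1)%:C) (istrigD tu (istrigJ tu)).
congr istrig; apply/funext => x; apply: complex_ext; rewrite !ReImE /= mul1r.
  by rewrite cosB; field.
by ring.
Qed.

Lemma cmeasurable_trigsum l : cmeasurable (trigsum l).
Proof.
apply: cmeasurable_sum => q; apply: cmeasurableM; first exact: cmeasurable_cst.
exact: cmeasurable_expi.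
Qed.

Lemma trigsum_bounded l : exists M : R, forall x, sqmod (trigsum l x) <= M.
Proof.
elim: l => [|q l [M HM]].
  by exists 0 => x; rewrite /trigsum big_nil sqmodE /= expr0n addr0.
exists (2 * sqmod q.2 + 2 * M) => x; rewrite /trigsum big_cons.
apply: le_trans (sqmodD_le _ _) _; rewrite sqmodM sqmod_expi mulr1.
by rewrite lerD2l ler_pM2l ?HM.
Qed.

End trigonometric_sums.

Section approximation.
Context {R : realType}.
Variable w : R -> R.
Hypotheses (iw : rint w) (w0 : forall x, circle x -> 0 <= w x).
Implicit Types (u v : R -> R[i]).

Definition cbounded u : Prop :=
  cmeasurable u /\ exists M : R, forall x, circle x -> sqmod (u x) <= M.

(** Membership in the closure of the trigonometric sums in L_2(w). Since [rmean] returns a default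
    value on non-integrable functions, boundedness is carried along to make the inequality
    meaningful. *)
Definition approximable u : Prop := forall e : R, 0 < e ->
  exists2 p, istrig p & rmean (fun x => sqmod (u x - p x) * w x) < e.

Lemma cbounded_trig u : istrig u -> cbounded u.
Proof.
move=> [l ->]; split; first exact: cmeasurable_trigsum.
by have [M HM] := trigsum_bounded l; exists M => x _.
Qed.

Lemma cboundedD u v : cbounded u -> cbounded v -> cbounded (fun x => u x + v x).
Proof.
move=> [mu [M HM]] [mv [K HK]]; split; first exact: cmeasurableD.
exists (2 * M + 2 * K) => x cx; apply: le_trans (sqmodD_le _ _) _.
by rewrite lerD // ler_pM2l // ?HM ?HK.
Qed.

Lemma cboundedM u v : cbounded u -> cbounded v -> cbounded (fun x => u x * v x).
Proof.
move=> [mu [M HM]] [mv [K HK]]; split; first exact: cmeasurableM.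
exists (M * K) => x cx; rewrite sqmodM.
by apply: ler_pM; rewrite ?sqmod_ge0 ?HM ?HK.
Qed.

Lemma cbounded_cst c : cbounded (cst c).
Proof. by split; [exact: cmeasurable_cst|exists (sqmod c)]. Qed.

Lemma cboundedZ c u : cbounded u -> cbounded (fun x => c * u x).
Proof. exact: cboundedM (cbounded_cst c). Qed.

Lemma cboundedB u v : cbounded u -> cbounded v -> cbounded (fun x => u x - v x).
Proof.
move=> bu bv; have := cboundedD bu (cboundedZ (-1) bv).
by under eq_fun do rewrite mulN1r.
Qed.

Lemma rint_sqmod_mul u (r : R -> R) : rint r -> cbounded u ->
  rint (fun x => sqmod (u x) * r x).
Proof.
move=> ir [mu [M HM]]; apply: (@rint_mul_bounded _ _ _ M) => //.
  exact: measurable_sqmod.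
by apply: ae_circleW => x cx; rewrite ger0_norm ?HM ?sqmod_ge0.
Qed.

Lemma approximable_close u :
  cbounded u ->
  (forall e : R, 0 < e -> exists2 v, cbounded v /\ approximable v &
     rmean (fun x => sqmod (u x - v x) * w x) < e) ->
  approximable u.
Proof.
(* [sqmodD_le] doubles each of the two squared errors, hence a quarter of [e] for each. *)
move=> bu H e e0; have e4 : 0 < e / 4 by rewrite divr_gt0.
have [v [bv av] uv] := H _ e4; have [p tp vp] := av _ e4.
exists p => //; have bp := cbounded_trig tp.
have i1 := rint_sqmod_mul iw (cboundedB bu bv).
have i2 := rint_sqmod_mul iw (cboundedB bv bp).
have i3 := rint_sqmod_mul iw (cboundedB bu bp).
apply: (@le_lt_trans _ _ (2 * rmean (fun x => sqmod (u x - v x) * w x)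
                        + 2 * rmean (fun x => sqmod (v x - p x) * w x))).
  rewrite -!rmeanZ // -rmeanD; [|exact: rintZ|exact: rintZ].
  apply: le_rmean => //; first by apply: rintD; exact: rintZ.
  apply: ae_circleW => x cx; rewrite !(mulrA 2 (sqmod _)) -mulrDl ler_wpM2r ?w0 //.
  have -> : u x - p x = (u x - v x) + (v x - p x) by rewrite addrA subrK.
  exact: sqmodD_le.
by lra.
Qed.

Lemma approximable_trig u : istrig u -> approximable u.
Proof.
move=> tu e e0; exists u => //; rewrite (_ : rmean _ = 0) //.
rewrite -[RHS](rmean_cst (0 : R)); apply: eq_rmean => x _.
by rewrite subrr sqmodE /= expr0n addr0 mul0r.
Qed.

Lemma approximableD u v : cbounded u -> cbounded v ->
  approximable u -> approximable v -> approximable (fun x => u x + v x).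
Proof.
move=> bu bv au av e e0; have e4 : 0 < e / 4 by rewrite divr_gt0.
have [p tp up] := au _ e4; have [q tq vq] := av _ e4.
exists (fun x => p x + q x); first exact: istrigD.
have bp := cbounded_trig tp; have bq := cbounded_trig tq.
have i1 := rint_sqmod_mul iw (cboundedB bu bp).
have i2 := rint_sqmod_mul iw (cboundedB bv bq).
have i3 := rint_sqmod_mul iw (cboundedB (cboundedD bu bv) (cboundedD bp bq)).
apply: (@le_lt_trans _ _ (2 * rmean (fun x => sqmod (u x - p x) * w x)
                        + 2 * rmean (fun x => sqmod (v x - q x) * w x))).
  rewrite -!rmeanZ // -rmeanD; [|exact: rintZ|exact: rintZ].
  apply: le_rmean => //; first by apply: rintD; exact: rintZ.
  apply: ae_circleW => x cx; rewrite !(mulrA 2 (sqmod _)) -mulrDl ler_wpM2r ?w0 //.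
  by rewrite opprD addrACA; exact: sqmodD_le.
by lra.
Qed.

Lemma approximableZ c u : cbounded u ->
  approximable u -> approximable (fun x => c * u x).
Proof.
(* The added 1 covers the case c = 0. *)
move=> bu au e e0; pose d := e / (sqmod c + 1).
have c1 : 0 < sqmod c + 1 by rewrite ltr_wpDl ?sqmod_ge0.
have d0 : 0 < d by rewrite divr_gt0.
have [p tp up] := au _ d0.
exists (fun x => c * p x); first exact: istrigM (istrig_cst c) tp.
have bp := cbounded_trig tp.
have i1 := rint_sqmod_mul iw (cboundedB bu bp).
rewrite (_ : rmean _ = sqmod c * rmean (fun x => sqmod (u x - p x) * w x)).
  have le0 : 0 <= rmean (fun x => sqmod (u x - p x) * w x).
    by apply: rmean_ge0 => //; apply: ae_circleW => x cx; rewrite mulr_ge0 ?sqmod_ge0 ?w0.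
  rewrite (_ : e = (sqmod c + 1) * d); last by rewrite mulrC divfK ?gt_eqF.
  apply: (@le_lt_trans _ _ ((sqmod c + 1) * rmean (fun x => sqmod (u x - p x) * w x))).
    by rewrite ler_wpM2r // lerDl.
  by rewrite ltr_pM2l.
by rewrite -rmeanZ //; apply: eq_rmean => x _; rewrite -mulrBr sqmodM mulrA.
Qed.

Lemma approximable_ext u v : {in circle, u =1 v} -> approximable u -> approximable v.
Proof.
move=> uv au e e0; have [p tp up] := au _ e0; exists p => //.
by rewrite (@eq_rmean _ _ (fun x => sqmod (u x - p x) * w x)) // => x cx; rewrite uv.
Qed.

Lemma rmean_cvg0 (v_ : nat -> R -> R) (g : R -> R) :
  (forall n, measurable_fun circle (v_ n)) -> rint g ->
  (forall n x, circle x -> `|v_ n x| <= g x) ->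
  ae_circle (fun x => v_ n x @[n --> \oo] --> (0 : R)) ->
  rmean (v_ n) @[n --> \oo] --> (0 : R).
Proof.
move=> mv ig vg v0.
have mv' n : measurable_fun circle (EFin \o v_ n) by exact/measurable_EFinP.
have m0 : measurable_fun (circle : set R) (cst 0%E : R -> \bar R) by exact: measurable_cst.
have cv : ae_circle (fun x => (v_ n x)%:E @[n --> \oo] --> (0 : \bar R)%E).
  apply: ae_circleS v0 => x _ cvx; apply/fine_cvgP; split; last exact: cvx.
  exact: nearW.
have dom : \forall x \ae (@lebesgue_measure R),
    forall n, circle x -> (`|(EFin \o v_ n) x| <= (EFin \o g) x)%E.
  by apply: aeW => x n cx /=; rewrite lee_fin vg.
have [_ _ H] := dominated_convergence measurable_circle mv' m0 cv ig dom.
rewrite integral0 in H.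
have {}H := fine_cvg H; rewrite -[X in _ --> X](mulr0 ((2 * pi)^-1 : R)).
by apply: cvgM; [exact: cvg_cst|exact: H].
Qed.

(** Dominated convergence: with [K] a bound for [sqmod (u x)], the squared errors stay below
    [(2 * K + 2 * M) * w x]. *)
Lemma approximable_lim (u_ : nat -> R -> R[i]) u (M : R) :
  (forall n, cbounded (u_ n)) -> (forall n, approximable (u_ n)) ->
  (forall n x, circle x -> sqmod (u_ n x) <= M) -> cbounded u ->
  ae_circle (fun x => sqmod (u x - u_ n x) @[n --> \oo] --> (0 : R)) ->
  approximable u.
Proof.
move=> bu_ au_ uM bu cu; apply: approximable_close => // e e0.
have [mu [K HK]] := bu.
suff /cvgr0_norm_lt/(_ _ e0) [n _ /(_ n (leqnn n)) Hn] :
    rmean (fun x => sqmod (u x - u_ n x) * w x) @[n --> \oo] --> (0 : R).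
  by exists (u_ n) => //; apply: le_lt_trans Hn; exact: ler_norm.
apply: (@rmean_cvg0 _ (fun x => (2 * K + 2 * M) * w x)).
- move=> n; apply: measurable_funM; last exact: rint_measurable.
  by apply: measurable_sqmod; apply: cmeasurableB => //; case: (bu_ n).
- exact: rintZ.
- move=> n x cx; rewrite normrM (ger0_norm (w0 cx)) ler_wpM2r ?w0 //.
  rewrite ger0_norm ?sqmod_ge0 //; apply: le_trans (sqmodD_le _ _) _.
  by rewrite sqmodN lerD // ler_pM2l ?HK ?uM.
- apply: ae_circleS cu => x cx ux; rewrite -[X in _ --> X](mul0r (w x)).
  by apply: cvgM; [exact: ux|exact: cvg_cst].
Qed.

End approximation.

(** * Bernstein's switching sequence *)

Section arcs.
Context {R : realType}.
Implicit Types (s y : R) (n m : nat).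

Lemma bernoulli_le y m : 0 <= y <= 1 -> 1 - m%:R * y <= (1 - y) ^+ m.
Proof.
move=> /andP[y0 y1]; elim: m => [|m IH]; first by rewrite mul0r subr0 expr0.
rewrite exprS; apply: (@le_trans _ _ ((1 - y) * (1 - m%:R * y))).
  rewrite -natr1 -subr_ge0.
  have -> : (1 - y) * (1 - m%:R * y) - (1 - (m%:R + 1) * y) = m%:R * y ^+ 2 by ring.
  by rewrite mulr_ge0 ?sqr_ge0.
by rewrite ler_wpM2l // subr_ge0.
Qed.

(** Bernoulli gives 1 + m y <= (1 + y)^m, and (1 - y)^m (1 + y)^m = (1 - y^2)^m <= 1. *)
Lemma pow_le_inv y m : 0 <= y <= 1 -> (1 - y) ^+ m * (1 + m%:R * y) <= 1.
Proof.
move=> /andP[y0 y1]; apply: (@le_trans _ _ ((1 - y) ^+ m * (1 + y) ^+ m)).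
  rewrite ler_wpM2l ?exprn_ge0 ?subr_ge0 //.
  elim: m => [|m IH]; first by rewrite mul0r addr0 expr0.
  rewrite exprS; apply: (@le_trans _ _ ((1 + y) * (1 + m%:R * y))).
    rewrite -natr1 -subr_ge0.
    have -> : (1 + y) * (1 + m%:R * y) - (1 + (m%:R + 1) * y) = m%:R * y ^+ 2 by ring.
    by rewrite mulr_ge0 ?sqr_ge0.
  by rewrite ler_wpM2l // addr_ge0.
rewrite -exprMn exprn_ile1 //.
  by rewrite mulr_ge0 ?subr_ge0 ?addr_ge0.
by rewrite -subr_ge0 (_ : 1 - _ = y ^+ 2) ?sqr_ge0 //; ring.
Qed.

(* Bernstein's switching sequence, separating s < 1/2 from s > 1/2. *)
Definition switch n s : R := (1 - s ^+ n) ^+ (2 ^ n).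

Lemma switch_bounds n s : 0 <= s <= 1 -> 0 <= switch n s <= 1.
Proof.
move=> /andP[s0 s1].
have h : 0 <= 1 - s ^+ n by rewrite subr_ge0 exprn_ile1.
by rewrite /switch exprn_ge0 //= exprn_ile1 // gerBl exprn_ge0.
Qed.

(** With y = s^n and m = 2^n one has m y = (2 s)^n, so Bernoulli bounds the sequence below by 1 - (2
    s)^n, where 2 s < 1. *)
Lemma switch_cvg1 s : 0 <= s -> s < 2^-1 -> switch n s @[n --> \oo] --> (1 : R).
Proof.
move=> s0 s2; have s1 : s <= 1 by lra.
have lim : (fun n => 1 - (2 * s) ^+ n) @ \oo --> (1 : R).
  rewrite -[X in _ --> X]subr0; apply: cvgB; first exact: cvg_cst.
  by apply: cvg_expr; rewrite ger0_norm ?mulr_ge0 //; lra.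
apply: (squeeze_cvgr _ lim (cvg_cst _)); apply: nearW => n.
have /andP[_ ->] := @switch_bounds n s (introT andP (conj s0 s1)).
rewrite andbT; have := @bernoulli_le (s ^+ n) (2 ^ n).
by rewrite exprMn -natrX; apply; rewrite exprn_ge0 ?exprn_ile1.
Qed.

(** With the same y and m, [pow_le_inv] bounds the sequence above by 1 / (m y) = (2 s)^-n, where now
    2 s > 1. *)
Lemma switch_cvg0 s : 2^-1 < s -> s <= 1 -> switch n s @[n --> \oo] --> (0 : R).
Proof.
move=> s2 s1; have s0 : 0 <= s by lra.
have p0 : 0 < 2 * s by lra.
have lim : (fun n => (2 * s)^-1 ^+ n) @ \oo --> (0 : R).
  apply: cvg_expr; rewrite ger0_norm ?invr_ge0 ?mulr_ge0 // invf_lt1 //; lra.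
apply: (squeeze_cvgr _ (cvg_cst _) lim); apply: nearW => n.
have /andP[sw0 _] := @switch_bounds n s (introT andP (conj s0 s1)).
rewrite sw0 /= exprVn -[leRHS]mul1r ler_pdivlMr ?exprn_gt0 //.
have := @pow_le_inv (s ^+ n) (2 ^ n).
rewrite exprn_ge0 ?exprn_ile1 // => /(_ isT); apply: le_trans.
by rewrite -/(switch n s) ler_wpM2l // exprMn natrX lerDr.
Qed.

End arcs.

(** * From arcs to Borel sets and bounded functions *)

Section indicators.
Context {R : realType}.
Variable w : R -> R.
Hypotheses (iw : rint w) (w0 : forall x, circle x -> 0 <= w x).

Definition ind (A : set R) (x : R) : R[i] := ((\1_A x : R))%:C.

Lemma sqmod_ind A x : sqmod (ind A x) <= 1.
Proof.
by rewrite sqmod_real indicE; case: (_ \in _); rewrite ?expr1n ?expr0n.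
Qed.

Lemma cbounded_ind A : measurable A -> cbounded (ind A).
Proof.
move=> mA; split; last by exists 1 => x _; exact: sqmod_ind.
by apply: cmeasurable_real; exact: measurable_indic.
Qed.

Lemma cbounded_real (r : R -> R) : measurable_fun circle r ->
  (forall x, circle x -> 0 <= r x <= 1) -> cbounded (fun x => (r x)%:C).
Proof.
move=> mr r01; split; first exact: cmeasurable_real.
exists 1 => x cx; rewrite sqmod_real; have /andP[r0 r1] := r01 x cx.
exact: exprn_ile1.
Qed.

Lemma approximable_ind_arc (b : R) : - pi < b -> b <= pi ->
  approximable w (ind `]-oo, b[).
Proof.
move=> b1 b2.
(* [x0] is the midpoint of [-pi, b] and [c] the common value of cos (x - x0) at its two ends, so [s]
   is below 1/2 inside this arc and above 1/2 on the rest of the circle. The factor 1/8 keeps [s]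
   within [0, 1]. *)
pose x0 := (b - pi) / 2; pose c := cos ((b + pi) / 2).
pose s x : R := 2^-1 - (cos (x - x0) - c) / 8.
(* In this product form, for -pi < x < pi, the first sine is positive and the second has the sign of
   b - x. *)
have sE x : s x = 2^-1 - sin ((x + pi) / 2) * sin ((b - x) / 2) / 4.
  rewrite /s /c (_ : x - x0 = (x + pi) / 2 - (b - x) / 2); last by rewrite /x0; field.
  rewrite (_ : (b + pi) / 2 = (x + pi) / 2 + (b - x) / 2); last by field.
  by rewrite cosB cosD; field.
have sb x : 0 <= s x <= 1.
  have := cos_geN1 (x - x0); have := cos_le1 (x - x0).
  by have := cos_geN1 ((b + pi) / 2); have := cos_le1 ((b + pi) / 2); rewrite /s /c; lra.
have ts : istrig (fun x => (s x)%:C).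
  have := istrigD (istrig_cst (2^-1 + c / 8)%:C)
            (istrigM (istrig_cst (- 8^-1)%:C) (istrig_cosB x0)).
  congr istrig; apply/funext => x; rewrite -rmorphM -rmorphD /=; congr (_%:C).
  by rewrite /s; field.
have tT n : istrig (fun x => (switch n (s x))%:C).
  have := istrigX (2 ^ n) (istrigD (istrig_cst 1)
    (istrigM (istrig_cst (-1)) (istrigX n ts))).
  congr istrig; apply/funext => x; rewrite /cst mulN1r /switch.
  have rX (y : R) k : (y ^+ k)%:C = y%:C ^+ k by exact: rmorphXn.
  have rB (y z : R) : (y - z)%:C = y%:C - z%:C by exact: rmorphB.
  (* The embedding of the reals is moved through the outer power, the difference and the inner power
     in turn. *)
  exact: (esym (etrans (rX _ _) (congr1 (fun z => z ^+ (2 ^ n))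
    (etrans (rB _ _) (congr1 (fun z => 1 - z) (rX _ _)))))).
apply: (@approximable_lim _ _ iw w0 (fun n x => (switch n (s x))%:C) _ 1).
- by move=> n; apply: cbounded_trig.
- by move=> n; apply: approximable_trig.
- move=> n x _; rewrite sqmod_real.
  by have /andP[? ?] := switch_bounds n (sb x); exact: exprn_ile1.
- exact: cbounded_ind.
(* At -pi, b and pi the value of [s] is 1/2, where the switching sequence tends to 1/e instead of 0
   or 1; these points form a null set. *)
suff H x : circle x -> x != - pi -> x != b -> x != pi ->
    sqmod (ind `]-oo, b[ x - (switch n (s x))%:C) @[n --> \oo] --> (0 : R).
  have neg (y : R) : ae_circle (fun x => x != y).
    exists [set y]; split; [exact: measurable_set1|exact: lebesgue_measure_set1|].
    by move=> x /= /not_implyP[_ /negP]; rewrite negbK => /eqP.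
  by apply: ae_circleS3 (neg (- pi)) (neg b) (neg pi) => x cx; apply: H.
rewrite /circle /= in_itv /= => /andP[l r] n1 n2 n3.
have xl : - pi < x by rewrite lt_neqAle eq_sym n1.
have xr : x < pi by rewrite lt_neqAle n3.
have p0 := pi_gt0 R.
have sp : 0 < sin ((x + pi) / 2) by apply: sin_gt0_pi; lra.
have key (t : R) : ind `]-oo, b[ x = t%:C ->
    switch n (s x) @[n --> \oo] --> t ->
    sqmod (ind `]-oo, b[ x - (switch n (s x))%:C) @[n --> \oo] --> (0 : R).
  move=> -> ct.
  have -> : (fun n => sqmod (t%:C - (switch n (s x))%:C)) =
            (fun n => (t - switch n (s x)) * (t - switch n (s x))).
    by apply/funext => n; rewrite sqmodE !ReImE /=; ring.
  have c0 : (fun n => t - switch n (s x)) @ \oo --> (0 : R).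
    by rewrite -(subrr t); apply: cvgB => //; exact: cvg_cst.
  have H := cvgM c0 c0; rewrite mulr0 in H; exact: H.
have /andP[s0 s1] := sb x.
have [xb|bx|xb] := ltgtP x b; last by rewrite xb eqxx in n2.
- apply: (key 1); first by rewrite /ind indicE mem_set //= in_itv.
  apply: switch_cvg1 => //; rewrite sE ltrBlDr ltrDl divr_gt0 //.
  by rewrite mulr_gt0 //; apply: sin_gt0_pi; lra.
- apply: (key 0).
    by rewrite /ind indicE memNset //= in_itv /= => /(lt_trans bx); rewrite ltxx.
  apply: switch_cvg0 => //; rewrite sE ltrBrDr gtrDl.
  rewrite (_ : (b - x) / 2 = - ((x - b) / 2)); last by field.
  rewrite sinN mulrN mulNr oppr_lt0 divr_gt0 // mulr_gt0 //.
  by apply: sin_gt0_pi; lra.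
Qed.

(** Dynkin's theorem: the rays []-oo, b[] are stable under intersection and generate the Borel sets,
    while approximability of the indicator passes to complements and, by bounded convergence, to
    countable disjoint unions. *)
Lemma approximable_ind (A : set R) : measurable A -> approximable w (ind A).
Proof.
have mE : @measurable _ (measurableTypeR R) = <<s @RGenInftyO.G R >>.
  exact: RGenInftyO.measurableE.
move=> mA; apply: (@dynkin_induction _ (measurableTypeR R) (@RGenInftyO.G R)
  (fun A => approximable w (ind A)) mE); last by rewrite -mE.
- move=> _ _ [x ->] [y ->]; exists (Num.min x y).
  by apply/seteqP; split => z /=; rewrite !in_itv /= lt_min => /andP.
- apply: (@approximable_ext _ _ (cst 1)).
    by move=> x _; rewrite /ind indicE in_setT.
  exact: approximable_trig (istrig_cst 1).
- move=> _ [b ->].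
  have [b1|b1] := leP b (- pi).
    apply: (@approximable_ext _ _ (cst 0)); last exact: approximable_trig (istrig_cst 0).
    move=> x /set_mem; rewrite /circle /= in_itv /= => /andP[lx _].
    rewrite /ind indicE memNset //= in_itv /= => xb.
    by have := lt_le_trans xb (le_trans b1 lx); rewrite ltxx.
  have [b2|b2] := leP b pi; first exact: approximable_ind_arc.
  apply: (@approximable_ext _ _ (cst 1)); last exact: approximable_trig (istrig_cst 1).
  move=> x /set_mem; rewrite /circle /= in_itv /= => /andP[_ xp].
  by rewrite /ind indicE mem_set //= in_itv /= (le_lt_trans xp).
- move=> S mS aS; apply: (@approximable_ext _ _ (fun x => cst 1 x + -1 * ind S x)).
    move=> x _; rewrite /ind !indicE in_setC.
    by apply: complex_ext; rewrite !ReImE /=; case: (x \in S); rewrite /=; ring.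
  apply: approximableD => //.
  + exact: cbounded_cst.
  + by apply: cboundedZ; exact: cbounded_ind.
  + exact: approximable_trig (istrig_cst 1).
  + by apply: approximableZ => //; exact: cbounded_ind.
- move=> F mF tF aF.
  pose U n := \bigcup_(k in `I_n) F k.
  have mU n : measurable (U n) by apply: bigcup_measurable => k _.
  have aU n : approximable w (ind (U n)).
    elim: n => [|n IH].
      apply: (@approximable_ext _ _ (cst 0)).
        by move=> x _; rewrite /ind indicE /U memNset // => -[].
      exact: approximable_trig (istrig_cst 0).
    apply: (@approximable_ext _ _ (fun x => ind (U n) x + ind (F n) x)).
      move=> x _; rewrite /ind !indicE.
      have [xn|xn] := pselect (F n x).
        have xU : ~ U n x.
          move=> [k /= kn xk].
          have kE := tF k n Logic.I Logic.I (ex_intro _ x (conj xk xn)).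
          by rewrite kE ltnn in kn.
        have xU1 : U n.+1 x by exists n => /=.
        by rewrite (mem_set xn) (memNset xU) (mem_set xU1) add0r.
      have UE : U n.+1 x <-> U n x.
        split=> -[k /= kn xk]; exists k => //=; last first.
          exact: leqW.
        rewrite ltn_neqAle -ltnS kn andbT; apply/eqP => kE.
        by apply: xn; rewrite -kE.
      rewrite (memNset xn) addr0.
      have [xU|xU] := pselect (U n x); first by rewrite !mem_set // UE.
      by rewrite !memNset // UE.
    apply: approximableD => //; first exact: (cbounded_ind (mU n)).
    exact: (cbounded_ind (mF n)).
  apply: (@approximable_lim _ _ iw w0 (fun n => ind (U n)) _ 1) => //.
  + by move=> n; exact: (cbounded_ind (mU n)).
  + by move=> n x _; exact: sqmod_ind.
  + exact: (cbounded_ind (bigcupT_measurable _ mF)).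
  apply: ae_circleW => x _; apply: cvg_near_cst.
  have [[k _ xk]|xn] := pselect ((\bigcup_k F k) x).
    exists k.+1 => // n /= kn.
    rewrite /ind !indicE (mem_set (_ : (\bigcup_k F k) x)); last by exists k.
    rewrite (mem_set (_ : U n x)); last by exists k.
    by rewrite subrr sqmodE /= expr0n addr0.
  apply: nearW => n; rewrite /ind !indicE (memNset xn) memNset.
    by rewrite subrr sqmodE /= expr0n addr0.
  by move=> [k _ xk]; apply: xn; exists k.
Qed.

(** One binary digit at a time: if [A] is the set where r >= 1/2, then r = (1_A + r') / 2, and r' =
    2 r - 1_A again takes values in [0, 1]. Halving the error divides its square by 4. *)
Lemma dyadic_approximation n (r : R -> R) : measurable_fun circle r ->
  (forall x, circle x -> 0 <= r x <= 1) ->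
  exists v, [/\ cbounded v, approximable w v &
    forall x, circle x -> sqmod ((r x)%:C - v x) <= 4^-1 ^+ n].
Proof.
elim: n r => [|n IH] r mr r01.
  exists (cst 0); split.
  - exact: cbounded_cst.
  - exact: approximable_trig (istrig_cst 0).
  - move=> x cx; rewrite subr0 sqmod_real expr0; have /andP[? ?] := r01 _ cx.
    exact: exprn_ile1.
pose A := circle `&` r @^-1` `[2^-1, +oo[.
have mA : measurable A by apply: mr => //; exact: measurable_itv.
have AE x : circle x -> (\1_A x : R) = ((2^-1 <= r x)%R : bool)%:R.
  move=> cx; rewrite indicE; congr (_ %:R); congr nat_of_bool.
  apply/idP/idP => [/set_mem [_]|rx]; first by rewrite /= in_itv /= andbT.
  by apply: mem_set; split => //=; rewrite in_itv /= rx.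
pose r' x := 2 * r x - \1_A x.
have mr' : measurable_fun circle r'.
  apply: measurable_funB; first exact: measurable_funM.
  exact: measurable_indic.
have [x cx|v [bv av vE]] := IH r' mr'.
  have /andP[? ?] := r01 x cx; rewrite /r' AE //.
  by case: (leP 2^-1 (r x)) => ? /=; rewrite ?mulr1n ?mulr0n; apply/andP; split; lra.
have bA := cbounded_ind mA; have bAv := cboundedD bA bv.
exists (fun x => (2^-1)%:C * (ind A x + v x)); split.
- exact: cboundedZ.
- apply: approximableZ => //; apply: approximableD => //.
  exact: approximable_ind.
- move=> x cx.
  have -> : (r x)%:C - (2^-1)%:C * (ind A x + v x) = (2^-1)%:C * ((r' x)%:C - v x).
    by apply: complex_ext; rewrite /r' /ind !ReImE /=; field.
  rewrite sqmodM sqmod_real [leRHS]exprS ler_pM ?sqmod_ge0 ?sqr_ge0 ?vE //.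
  by rewrite exprVn -natrX.
Qed.

Lemma approximable_unit (r : R -> R) : measurable_fun circle r ->
  (forall x, circle x -> 0 <= r x <= 1) -> approximable w (fun x => (r x)%:C).
Proof.
move=> mr r01; have br := cbounded_real mr r01.
apply: approximable_close => // e e0.
have lim : (fun n => 4^-1 ^+ n * rmean w) @ \oo --> (0 : R).
  rewrite -[X in _ --> X](mul0r (rmean w)).
  apply: cvgM; last exact: cvg_cst.
  by apply: cvg_expr; rewrite ger0_norm ?invr_ge0 // invf_lt1 // ltr1n.
have /cvgr0_norm_lt/(_ _ e0) [n _ /(_ n (leqnn n)) Hn] := lim.
have [v [bv av vE]] := dyadic_approximation n mr r01.
exists v => //; apply: le_lt_trans (le_lt_trans (ler_norm _) Hn).
rewrite -rmeanZ //; apply: le_rmean.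
- by apply: rint_sqmod_mul => //; exact: cboundedB.
- exact: rintZ.
- by apply: ae_circleW => x cx; rewrite ler_wpM2r ?w0 ?vE.
Qed.

Lemma approximable_real (r : R -> R) (M : R) : measurable_fun circle r ->
  (forall x, circle x -> `|r x| <= M) -> approximable w (fun x => (r x)%:C).
Proof.
(* [r] is rescaled affinely into [0, 1]; the added 1 makes [K] positive. *)
move=> mr rM; pose K := `|M| + 1.
have K0 : 0 < K by rewrite ltr_wpDl.
pose q x := (2 * K)^-1 * (r x + K).
have mq : measurable_fun circle q.
  by apply: measurable_funM => //; apply: measurable_funD.
have q01 x : circle x -> 0 <= q x <= 1.
  move=> cx; have := rM x cx; rewrite ler_norml => /andP[l1 l2].
  have lM := ler_norm M; have K2 : 0 < 2 * K by rewrite mulr_gt0.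
  rewrite /q mulrC ler_pdivrMr // divr_ge0 ?(ltW K2) //=.
    by rewrite /K; lra.
  by rewrite /K; lra.
have aq := approximable_unit mq q01; have bq := cbounded_real mq q01.
have bZ := cboundedZ (2 * K)%:C bq.
have bC := cbounded_cst (- K)%:C.
apply: (@approximable_ext _ _ (fun x => (2 * K)%:C * (q x)%:C + cst (- K)%:C x)).
  move=> x _; apply: complex_ext; rewrite !ReImE /= /q.
    by field; rewrite gt_eqF.
  by ring.
apply: approximableD => //; first exact: approximableZ.
exact: approximable_trig (istrig_cst _).
Qed.

Lemma approximable_bounded (u : R -> R[i]) : cbounded u -> approximable w u.
Proof.
move=> [[mr mi] [M HM]].
have ar : approximable w (fun x => (complex.Re (u x))%:C).
  apply: (@approximable_real _ (Num.sqrt M)) => // x cx.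
  by apply: le_trans (norm_Re_le _) _; rewrite ler_wsqrtr ?HM.
have ai : approximable w (fun x => (complex.Im (u x))%:C).
  apply: (@approximable_real _ (Num.sqrt M)) => // x cx.
  by apply: le_trans (norm_Im_le _) _; rewrite ler_wsqrtr ?HM.
have br : cbounded (fun x => (complex.Re (u x))%:C).
  split; first exact: cmeasurable_real.
  exists M => x cx; rewrite sqmod_real; apply: le_trans (HM x cx).
  by rewrite sqmodE lerDl sqr_ge0.
have bi : cbounded (fun x => (complex.Im (u x))%:C).
  split; first exact: cmeasurable_real.
  exists M => x cx; rewrite sqmod_real; apply: le_trans (HM x cx).
  by rewrite sqmodE lerDr sqr_ge0.
apply: (@approximable_ext _ _
  (fun x => (complex.Re (u x))%:C + 'i%C * (complex.Im (u x))%:C)).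
  by move=> x _; apply: complex_ext; rewrite !ReImE /=; ring.
apply: approximableD => //; first exact: cboundedZ.
exact: approximableZ.
Qed.

End indicators.

(** * The observed span *)

Section real_inner_product.
Context {R : realType}.
Implicit Types z w : R[i].

(** The real part of the Hermitian product. Orthogonality in this sense to [trigpoly c] for all
    complex [c] is complex orthogonality, since [c] may be multiplied by i. *)
Definition dotr z w : R := complex.Re z * complex.Re w + complex.Im z * complex.Im w.

Lemma Re_mulJ z w : complex.Re (z * conjc w) = dotr z w.
Proof. by rewrite !ReImE /dotr; ring. Qed.

Lemma dotrDl z z' w : dotr (z + z') w = dotr z w + dotr z' w.
Proof. by rewrite /dotr !ReImE; ring. Qed.

Lemma dotrBl z z' w : dotr (z - z') w = dotr z w - dotr z' w.
Proof. by rewrite /dotr !ReImE; ring. Qed.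

Lemma dotrr z : dotr z z = sqmod z.
Proof. by rewrite /dotr sqmodE !expr2. Qed.

(** Young's inequality, from (t a - b)^2 >= 0 and (t a + b)^2 >= 0 in each coordinate. The free [t]
    replaces the Cauchy-Schwarz inequality and may depend on the point of the circle. *)
Lemma norm_dotr_le z w (t : R) : 0 < t ->
  `|dotr z w| <= t / 2 * sqmod z + sqmod w / t / 2.
Proof.
move=> t0; have H (a b : R) : a * b <= t / 2 * a ^+ 2 + b ^+ 2 / t / 2
    /\ - (a * b) <= t / 2 * a ^+ 2 + b ^+ 2 / t / 2.
  split; rewrite -subr_ge0.
    have -> : t / 2 * a ^+ 2 + b ^+ 2 / t / 2 - a * b = (t * a - b) ^+ 2 / t / 2.
      by field; rewrite gt_eqF.
    by rewrite !divr_ge0 ?sqr_ge0 ?(ltW t0).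
  have -> : t / 2 * a ^+ 2 + b ^+ 2 / t / 2 - - (a * b) = (t * a + b) ^+ 2 / t / 2.
    by field; rewrite gt_eqF.
  by rewrite !divr_ge0 ?sqr_ge0 ?(ltW t0).
have [h1 h2] := H (complex.Re z) (complex.Re w).
have [h3 h4] := H (complex.Im z) (complex.Im w).
rewrite !sqmodE /dotr ler_norml !mulrDl mulrDr; apply/andP; split; lra.
Qed.

Lemma sqmod_sum_le I (r : seq I) (F : I -> R[i]) :
  sqmod (\sum_(i <- r) F i) <= 2 ^+ size r * \sum_(i <- r) sqmod (F i).
Proof.
elim: r => [|i r IH]; first by rewrite !big_nil sqmodE /= expr0n mulr0 addr0.
rewrite !big_cons /= exprS; apply: le_trans (sqmodD_le _ _) _.
rewrite -mulrA -mulrDr ler_pM2l // mulrDr lerD //.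
by rewrite ler_peMl ?sqmod_ge0 // exprn_ege1 // ler1n.
Qed.

End real_inner_product.

(** * Observed frequencies against the frequencies 0, ..., N *)

Section observed_sums.
Context {R : realType}.
Variable N : nat.
Implicit Types (l : seq (int * R[i])) (c : 'cV[R[i]]_N.+1).

Definition coef l (j : int) : R[i] := \sum_(q <- l | q.1 == j) q.2.

(** [observed_span] attaches one coefficient to each frequency, so repeated frequencies are merged:
    [undup] keeps one copy of each and [coef] adds up its coefficients. *)
Lemma observed_span_trigsum l : all (fun q => observed N q.1) l ->
  observed_span N (trigsum l).
Proof.
move=> ol; exists (undup (map fst l)), (coef l); split.
  apply/allP => j; rewrite mem_undup => /mapP[q ql ->].
  exact: (allP ol).
apply/funext => x; rewrite /trigsum /coef.
under [RHS]eq_bigr do rewrite mulr_suml.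
rewrite (exchange_big_dep predT) //= big_seq [RHS]big_seq.
apply: eq_bigr => q ql; rewrite big_mkcond /= (bigD1_seq q.1) ?undup_uniq //=.
  rewrite eqxx big1 ?addr0 // => j.
  by rewrite eq_sym => /negbTE ->.
by rewrite mem_undup; apply: map_f.
Qed.

Lemma observedPn (j : int) : ~~ observed N j -> exists k : 'I_N.+1, j = k%:Z.
Proof.
rewrite /observed negbK; case: j => n; last by rewrite andbC.
rewrite andTb lez_nat => nN.
by exists (Ordinal (nN : (n < N.+1)%N)).
Qed.

Lemma observed_ord (k : 'I_N.+1) : observed N k%:Z = false.
Proof. by rewrite /observed /= lez_nat -ltnS ltn_ord. Qed.

Lemma trigsum_split l : exists s l', observed_span N (trigsum l') /\
  forall x, trigsum l x = @trigpoly R N s x + trigsum l' x.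
Proof.
exists (\col_j coef l j%:Z), [seq q <- l | observed N q.1]; split.
  by apply: observed_span_trigsum; exact: filter_all.
move=> x; rewrite /trigsum /trigpoly (bigID (fun q => ~~ observed N q.1)) /=.
rewrite big_filter; congr (_ + _); last by apply: eq_bigl => q; rewrite negbK.
under [RHS]eq_bigr do rewrite mxE /coef mulr_suml.
rewrite (exchange_big_dep (fun q => ~~ observed N q.1)) /=; last first.
  by move=> k q _ /eqP ->; rewrite observed_ord.
apply: eq_bigr => q /observedPn[k kE].
rewrite (bigD1 k) ?kE //= big1 ?addr0 // => j /andP[/eqP []] /val_inj -> .
by rewrite eqxx.
Qed.

Lemma conj_trigpoly c x :
  conjc (trigpoly c x) = \sum_(k < N.+1) conjc (c k 0) * expi (- k%:Z) x.
Proof. by rewrite conjc_sum; apply: eq_bigr => k _; rewrite conjcM conj_expi. Qed.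

Lemma cmeasurable_trigpoly c : cmeasurable (trigpoly c).
Proof.
apply: cmeasurable_sum => k; apply: cmeasurableM; first exact: cmeasurable_cst.
exact: cmeasurable_expi.
Qed.

Lemma trigpoly_bounded c : exists M : R, forall x, sqmod (trigpoly c x) <= M.
Proof.
exists (2 ^+ size (index_enum 'I_N.+1) * \sum_(k < N.+1) sqmod (c k 0)) => x.
apply: le_trans (sqmod_sum_le _ _) _; rewrite ler_wpM2l ?exprn_ge0 // ler_sum //.
by move=> k _; rewrite sqmodM sqmod_expi mulr1.
Qed.

Lemma cbounded_trigpoly c : cbounded (trigpoly c).
Proof.
split; first exact: cmeasurable_trigpoly.
by have [M HM] := trigpoly_bounded c; exists M => x _.
Qed.

Lemma cmean_expi_trigpoly (j : int) c :
  cmean (fun x => expi j x * conjc (trigpoly c x)) =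
  \sum_(k < N.+1) conjc (c k 0) * (j == k%:Z)%:R.
Proof.
have -> : (fun x => expi j x * conjc (trigpoly c x)) =
    (fun x => \sum_(k < N.+1) conjc (c k 0) * expi (j - k%:Z) x).
  apply/funext => x; rewrite conj_trigpoly mulr_sumr; apply: eq_bigr => k _.
  by rewrite mulrCA expiD.
rewrite cmean_sum; last by move=> k; apply: cintZ; exact: cint_expi.
apply: eq_bigr => k _; rewrite cmeanZ; last exact: cint_expi.
by rewrite cmean_expi subr_eq0.
Qed.

Lemma cint_expi_trigpoly (j : int) c : cint (fun x => expi j x * conjc (trigpoly c x)).
Proof.
have -> : (fun x => expi j x * conjc (trigpoly c x)) =
    (fun x => \sum_(k < N.+1) conjc (c k 0) * expi (j - k%:Z) x).
  apply/funext => x; rewrite conj_trigpoly mulr_sumr; apply: eq_bigr => k _.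
  by rewrite mulrCA expiD.
by apply: cint_sum => k; apply: cintZ; exact: cint_expi.
Qed.

Lemma cmean_observed q c : observed_span N q ->
  cint (fun x => q x * conjc (trigpoly c x)) /\
  cmean (fun x => q x * conjc (trigpoly c x)) = 0.
Proof.
move=> [s [d [os ->]]].
have -> : (fun x => (\sum_(j <- s) d j * expi j x) * conjc (trigpoly c x)) =
    (fun x => \sum_(j <- s) d j * (expi j x * conjc (trigpoly c x))).
  by apply/funext => x; rewrite mulr_suml; apply: eq_bigr => j _; rewrite mulrA.
have iE j : cint (fun x => d j * (expi j x * conjc (trigpoly c x))).
  by apply: cintZ; exact: cint_expi_trigpoly.
split; first exact: cint_sum.
rewrite cmean_sum // big_seq big1 // => j js.
rewrite cmeanZ; last exact: cint_expi_trigpoly.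
rewrite cmean_expi_trigpoly big1 ?mulr0 // => k _.
case: eqP => [jk|_]; last by rewrite mulr0.
by have := allP os j js; rewrite jk observed_ord.
Qed.

Lemma rmean_dotr_observed q c : observed_span N q ->
  rmean (fun x => dotr (q x) (trigpoly c x)) = 0.
Proof.
move=> oq; have [_] := cmean_observed c oq.
rewrite cmeanE => -[/= <- _]; apply: eq_rmean => x _.
by rewrite Re_mulJ.
Qed.

(** Parseval's identity for the frequencies 0, ..., N. *)
Lemma rmean_sqmod_trigpoly c :
  rmean (fun x => sqmod (trigpoly c x)) = \sum_(k < N.+1) sqmod (c k 0).
Proof.
have E : cmean (fun x => trigpoly c x * conjc (trigpoly c x)) =
         \sum_(k < N.+1) c k 0 * conjc (c k 0).
  have -> : (fun x => trigpoly c x * conjc (trigpoly c x)) =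
      (fun x => \sum_(j < N.+1) c j 0 * (expi j%:Z x * conjc (trigpoly c x))).
    by apply/funext => x; rewrite {1}/trigpoly mulr_suml; apply: eq_bigr => j _; rewrite mulrA.
  rewrite cmean_sum; last by move=> j; apply: cintZ; exact: cint_expi_trigpoly.
  apply: eq_bigr => j _; rewrite cmeanZ; last exact: cint_expi_trigpoly.
  rewrite cmean_expi_trigpoly (bigD1 j) //= eqxx mulr1 big1 ?addr0 // => k kj.
  by rewrite eqz_nat (inj_eq val_inj) eq_sym (negbTE kj) mulr0.
move/(congr1 (@complex.Re R)) : E; rewrite cmeanE /= Re_sum => E.
rewrite (_ : rmean _ = rmean (fun x => complex.Re (trigpoly c x * conjc (trigpoly c x)))).
  by rewrite E; apply: eq_bigr => k _; rewrite Re_mulJ dotrr.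
by apply: eq_rmean => x _; rewrite Re_mulJ dotrr.
Qed.

End observed_sums.

Section observed_space.
Context {R : realType}.
Variables (N : nat) (w : R -> R).
Hypotheses (iw : rint w) (w0 : forall x, circle x -> 0 <= w x).
Implicit Types (h p u : R -> R[i]) (c : 'cV[R[i]]_N.+1).

(** Setting [h] to 0 on the null set where the bound fails gives a function bounded everywhere, with
    the same distance to trigonometric sums. *)
Lemma approximable_ae_bounded h (M : R) : cmeasurable h ->
  ae_circle (fun x => sqmod (h x) <= M) -> approximable w h.
Proof.
move=> mh hM e e0.
pose A := circle `&` (fun x => sqmod (h x)) @^-1` `]-oo, M].
have mA : measurable A by apply: measurable_sqmod => //; exact: measurable_itv.
pose u x := h x * ind A x.
have AE x : circle x -> ind A x = ((sqmod (h x) <= M)%R : bool)%:R%:C.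
  move=> cx; rewrite /ind indicE; congr (_ %:R%:C); congr nat_of_bool.
  apply/idP/idP => [/set_mem [_]|rx]; first by rewrite /= in_itv.
  by apply: mem_set; split => //=; rewrite in_itv /= rx.
have bu : cbounded u.
  split; first by apply: cmeasurableM => //; case: (cbounded_ind mA).
  (* Outside [A] the value is 0, which need not be at most [M]. *)
  exists (Num.max M 0) => x cx; rewrite /u sqmodM AE // sqmod_real le_max.
  by case: (leP (sqmod (h x)) M) => hx /=;
    rewrite ?mulr1n ?mulr0n ?expr1n ?mulr1 ?hx // expr0n mulr0 lexx orbT.
have [p tp up] := approximable_bounded iw w0 bu e0.
exists p => //; apply: le_lt_trans up.
have [mp _] := cbounded_trig tp; have [K HK] := (cbounded_trig tp).2.
apply: le_rmean.
- apply: (@rint_mul_bounded _ _ _ (2 * M + 2 * K)) => //.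
    by apply: measurable_sqmod; exact: cmeasurableB.
  apply: ae_circleS hM => x cx hx; rewrite ger0_norm ?sqmod_ge0 //.
  apply: le_trans (sqmodD_le _ _) _.
  by rewrite sqmodN lerD // ler_pM2l ?HK.
- by apply: rint_sqmod_mul => //; apply: cboundedB => //; exact: cbounded_trig.
- by apply: ae_circleS hM => x cx hx; rewrite /u AE // hx mulr1.
Qed.

End observed_space.

(** * The observed span as an orthogonal complement *)

Section orthogonality.
Context {R : realType}.
Variables (N : nat).
Implicit Types (w : R -> R) (h p u : R -> R[i]) (c : 'cV[R[i]]_N.+1).

Lemma measurable_dotr u h : cmeasurable u -> cmeasurable h ->
  measurable_fun circle (fun x => dotr (u x) (h x)).
Proof.
by move=> [? ?] [? ?]; apply: measurable_funD; exact: measurable_funM.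
Qed.

Lemma rint_dotr u h : cmeasurable u -> cmeasurable h ->
  rint (fun x => sqmod (u x)) -> rint (fun x => sqmod (h x)) ->
  rint (fun x => dotr (u x) (h x)).
Proof.
move=> mu mh iu ih.
apply: (@rint_le _ _ (fun x => 2^-1 * sqmod (u x) + 2^-1 * sqmod (h x))).
- exact: measurable_dotr.
- apply: ae_circleW => x _; apply: le_trans (norm_dotr_le _ _ ltr01) _.
  by rewrite divr1 mul1r [_ / 2]mulrC.
- by apply: rintD; exact: rintZ.
Qed.

(** Equivalence of norms in finite dimension: it bounds uniformly, hence in any integrable weight, a
    polynomial known to be small in mean square. *)
Lemma sqmod_trigpoly_le c x :
  sqmod (trigpoly c x) <=
  2 ^+ size (index_enum 'I_N.+1) * rmean (fun y => sqmod (trigpoly c y)).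
Proof.
rewrite rmean_sqmod_trigpoly; apply: le_trans (sqmod_sum_le _ _) _.
rewrite ler_wpM2l ?exprn_ge0 // ler_sum //.
by move=> k _; rewrite sqmodM sqmod_expi mulr1.
Qed.

(** The unobserved part [trigpoly s] of an approximant of [h] is the projection onto frequencies 0,
    ..., N of the error alone, because [h] has no component there. It is thus as small as the error
    and can be discarded. *)
Lemma L2N_bounded w h (M : R) : rint w -> (forall x, circle x -> 0 <= w x) ->
  cmeasurable h -> ae_circle (fun x => sqmod (h x) <= M) ->
  (forall c, rmean (fun x => dotr (h x) (trigpoly c x)) = 0) ->
  L2N N w h.
Proof.
move=> iw w0 mh hM ho.
have ihr (r : R -> R) : rint r -> rint (fun x => sqmod (h x) * r x).
  move=> ir; apply: (@rint_mul_bounded _ _ _ M) => //; first exact: measurable_sqmod.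
  by apply: ae_circleS hM => x cx hx; rewrite ger0_norm ?sqmod_ge0.
have [mr mi] := mh; split => //; first by rewrite (emean_rmean (ihr _ iw)) ltry.
move=> e e0.
pose K : R := 2 ^+ size (index_enum 'I_N.+1).
have K0 : 0 <= K by rewrite exprn_ge0.
have mw0 : 0 <= rmean w by apply: rmean_ge0 => //; exact: ae_circleW.
(* The total loss in the final estimate: 2 from the approximation, and [2 * K * rmean w] from
   discarding [trigpoly s]. *)
pose B := 2 + 2 * K * rmean w; have B0 : 0 < B.
  by rewrite /B ltr_pwDl // mulr_ge0 // mulr_ge0.
(* This weight controls the L_2(w) error and also the unweighted one, in which the projection is
   estimated. *)
pose w1 x := w x + 1.
have iw1 : rint w1 by apply: rintD => //; exact: rint_cst.
have w10 x : circle x -> 0 <= w1 x by move=> cx; rewrite addr_ge0 ?w0.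
have eB : 0 < e / B by rewrite divr_gt0.
have [_ [l ->] lp] := approximable_ae_bounded iw1 w10 mh hM eB.
have [s [l' [ol' lE]]] := trigsum_split N l.
have bl := cbounded_trig (ex_intro _ l erefl : istrig (trigsum l)).
have bl' := cbounded_trig (ex_intro _ l' erefl : istrig (trigsum l')).
have bs := cbounded_trigpoly s.
have ihl (r : R -> R) u : rint r -> cbounded u ->
    rint (fun x => sqmod (h x - u x) * r x).
  move=> ir [mu [L HL]]; apply: (@rint_mul_bounded _ _ _ (2 * M + 2 * L)) => //.
    by apply: measurable_sqmod; exact: cmeasurableB.
  apply: ae_circleS hM => x cx hx; rewrite ger0_norm ?sqmod_ge0 //.
  apply: le_trans (sqmodD_le _ _) _.
  by rewrite sqmodN lerD // ler_pM2l ?HL.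
have ihl1 u : cbounded u -> rint (fun x => sqmod (h x - u x)).
  move=> bu; have := ihl _ _ (rint_cst 1) bu.
  by under eq_fun do rewrite /= mulr1.
have is1 : rint (fun x => sqmod (trigpoly s x)).
  have := rint_sqmod_mul (rint_cst 1) bs.
  by under eq_fun do rewrite /= mulr1.
pose sg := rmean (fun x => sqmod (trigpoly s x)).
have sgle : sg <= rmean (fun x => sqmod (h x - trigsum l x)).
  have i1 : rint (fun x => dotr (h x) (trigpoly s x)).
    apply: rint_dotr => //; first by case: bs.
    have := ihr _ (rint_cst 1).
    by under eq_fun do rewrite /= mulr1.
  have i2 : rint (fun x => dotr (trigsum l' x) (trigpoly s x)).
    have [[+ _] _] := cmean_observed s ol'.
    by under eq_fun do rewrite Re_mulJ.
  have i3 : rint (fun x => dotr (h x - trigsum l x) (trigpoly s x)).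
    apply: rint_dotr => //; last exact: ihl1.
      by apply: cmeasurableB => //; case: bl.
    by case: bs.
  (* Both [h] and [trigsum l'] are orthogonal to [trigpoly s]. Young's inequality with t = 1 then
     leaves half of [sg] on the right, to be absorbed. *)
  have sgE : - sg = rmean (fun x => dotr (h x - trigsum l x) (trigpoly s x)).
    have -> : rmean (fun x => dotr (h x - trigsum l x) (trigpoly s x)) =
        rmean (fun x => (dotr (h x) (trigpoly s x) - dotr (trigsum l' x) (trigpoly s x))
                        - sqmod (trigpoly s x)).
      by apply: eq_rmean => x _; rewrite dotrBl lE dotrDl dotrr; ring.
    rewrite rmeanB //; last exact: rintB.
    by rewrite rmeanB // ho rmean_dotr_observed // subr0 sub0r.
  have : - rmean (fun x => dotr (h x - trigsum l x) (trigpoly s x)) <=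
         rmean (fun x => 2^-1 * sqmod (h x - trigsum l x) + 2^-1 * sqmod (trigpoly s x)).
    rewrite -rmeanN //; apply: le_rmean; first exact: rintN.
      by apply: rintD; apply: rintZ => //; exact: ihl1.
    apply: ae_circleW => x _; apply: le_trans (ler_norm _) _; rewrite normrN.
    by apply: le_trans (norm_dotr_le _ _ ltr01) _; rewrite divr1 mul1r [_ / 2]mulrC.
  rewrite -sgE opprK rmeanD; [|exact/rintZ/ihl1|exact: rintZ].
  rewrite !rmeanZ //; last exact: ihl1.
  by rewrite -/sg; lra.
have le1 : rmean (fun x => sqmod (h x - trigsum l x)) <=
           rmean (fun x => sqmod (h x - trigsum l x) * w1 x).
  apply: le_rmean; [exact: ihl1|exact: ihl|].
  by apply: ae_circleW => x cx; rewrite ler_peMr ?sqmod_ge0 // lerDr w0.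
have le2 : rmean (fun x => sqmod (h x - trigsum l x) * w x) <=
           rmean (fun x => sqmod (h x - trigsum l x) * w1 x).
  apply: le_rmean; [exact: ihl|exact: ihl|].
  by apply: ae_circleW => x cx; rewrite ler_wpM2l ?sqmod_ge0 // lerDl.
exists (trigsum l') => //; rewrite emean_rmean ?lte_fin; last exact: ihl.
apply: (@le_lt_trans _ _ (2 * rmean (fun x => sqmod (h x - trigsum l x) * w x)
                          + 2 * (K * sg) * rmean w)).
  rewrite -(rmeanZ 2 (ihl _ _ iw bl)) -(rmeanZ (2 * (K * sg)) iw).
  rewrite -rmeanD; [|exact/rintZ/ihl|exact: rintZ].
  apply: le_rmean; [exact: ihl|by apply: rintD; apply: rintZ => //; exact: ihl|].
  apply: ae_circleW => x cx; rewrite (mulrA 2 (sqmod _)) -mulrDl ler_wpM2r ?w0 //.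
  have -> : h x - trigsum l' x = (h x - trigsum l x) + trigpoly s x.
    by rewrite lE; ring.
  apply: le_trans (sqmodD_le _ _) _; rewrite lerD2l.
  rewrite ler_pM2l //.
  exact: sqmod_trigpoly_le.
have {}lp : B * rmean (fun x => sqmod (h x - trigsum l x) * w1 x) < e.
  by rewrite mulrC -ltr_pdivlMr.
apply: le_lt_trans lp.
have := ler_wpM2l (mulr_ge0 K0 mw0) (le_trans sgle le1).
rewrite /B; move: le2; set a := rmean _; set b := rmean _; set m := rmean w.
nra.
Qed.

(* The minimality hypothesis makes the first N+1 Fourier coefficients continuous
   on L_2(w). *)
Lemma L2N_orthogonal w h c : rint w -> (forall x, circle x -> 0 <= w x) ->
  ae_circle (fun x => 0 < w x) -> rint (fun x => (w x)^-1) -> L2N N w h ->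
  rint (fun x => dotr (h x) (trigpoly c x)) /\
  rmean (fun x => dotr (h x) (trigpoly c x)) = 0.
Proof.
move=> iw w0 wp iv [mr mi hfin happ].
have mh : cmeasurable h by [].
have mw := rint_measurable iw.
have bc := cbounded_trigpoly c; have [mc _] := bc.
have isq u : cmeasurable u -> (emean (fun x => sqmod (u x) * w x)%R < +oo)%E ->
    rint (fun x => sqmod (u x) * w x).
  move=> mu; apply: rint_emean.
    by apply: measurable_funM => //; exact: measurable_sqmod.
  by move=> x cx; rewrite mulr_ge0 ?sqmod_ge0 ?w0.
have ic := rint_sqmod_mul iv bc.
(* Young's inequality with parameter [t * w x] at the point x: the weight [w] falls on [u] and its
   inverse, integrable by hypothesis, on the bounded polynomial. *)
have key u (t : R) : 0 < t -> cmeasurable u -> rint (fun x => sqmod (u x) * w x) ->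
    rint (fun x => dotr (u x) (trigpoly c x)) /\
    `|rmean (fun x => dotr (u x) (trigpoly c x))| <=
      t / 2 * rmean (fun x => sqmod (u x) * w x) +
      (2 * t)^-1 * rmean (fun x => sqmod (trigpoly c x) / w x).
  move=> t0 mu iu.
  have dle : ae_circle (fun x => `|dotr (u x) (trigpoly c x)| <=
      t / 2 * (sqmod (u x) * w x) + (2 * t)^-1 * (sqmod (trigpoly c x) / w x)).
    apply: ae_circleS wp => x cx wx.
    apply: le_trans (norm_dotr_le _ _ (mulr_gt0 t0 wx)) _.
    rewrite le_eqVlt; apply/orP; left; apply/eqP; field.
    by rewrite !gt_eqF.
  have ir : rint (fun x => t / 2 * (sqmod (u x) * w x) +
                           (2 * t)^-1 * (sqmod (trigpoly c x) / w x)).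
    by apply: rintD; exact: rintZ.
  have id : rint (fun x => dotr (u x) (trigpoly c x)).
    by apply: rint_le dle ir; exact: measurable_dotr.
  split => //; rewrite -!rmeanZ // -rmeanD; [|exact: rintZ|exact: rintZ].
  rewrite ler_norml lerNl -rmeanN //; apply/andP; split.
    apply: le_rmean => //; first exact: rintN.
    apply: ae_circleS dle => x _; apply: le_trans; rewrite -normrN; exact: ler_norm.
  apply: le_rmean => //.
  by apply: ae_circleS dle => x _; apply: le_trans; exact: ler_norm.
have [ih _] := key h 1 ltr01 mh (isq _ mh hfin).
split => //; apply/eqP; rewrite -normr_le0; apply/ler_addgt0Pr => d d0; rewrite add0r.
set L := rmean (fun x => sqmod (trigpoly c x) / w x) in key.
have L0 : 0 <= L.
  apply: rmean_ge0 => //; apply: ae_circleS wp => x _ wx.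
  by rewrite divr_ge0 ?sqmod_ge0 ?ltW.
(* With this [t] the second term of [key] is at most d / 2, and an approximant within d / t makes
   the first at most d / 2. The added 1 allows L = 0. *)
pose t := (L + 1) / d; have t0 : 0 < t by rewrite divr_gt0 // ltr_wpDl.
have dt : 0 < d / t by rewrite divr_gt0.
have [q oq hq] := happ _ dt.
have mq : cmeasurable q.
  have [s [g [_ ->]]] := oq; apply: cmeasurable_sum => j.
  by apply: cmeasurableM; [exact: cmeasurable_cst|exact: cmeasurable_expi].
have mhq := cmeasurableB mh mq.
have ihq := isq _ mhq (lt_trans hq (ltry _)).
have [id dle] := key _ t t0 mhq ihq.
have [[iq _] _] := cmean_observed c oq.
have {}iq : rint (fun x => dotr (q x) (trigpoly c x)).
  by move: iq; under eq_fun do rewrite Re_mulJ.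
have -> : rmean (fun x => dotr (h x) (trigpoly c x)) =
          rmean (fun x => dotr (h x - q x) (trigpoly c x)).
  have -> : rmean (fun x => dotr (h x - q x) (trigpoly c x)) =
     rmean (fun x => dotr (h x) (trigpoly c x) - dotr (q x) (trigpoly c x)).
    by apply: eq_rmean => x _; rewrite dotrBl.
  by rewrite [RHS]rmeanB // (rmean_dotr_observed c oq) subr0.
apply: le_trans dle _; rewrite emean_rmean // lte_fin in hq.
have h1 : t / 2 * rmean (fun x => sqmod (h x - q x) * w x) <= d / 2.
  rewrite (_ : d / 2 = t / 2 * (d / t)); last by field; rewrite gt_eqF.
  by apply: ler_wpM2l; [rewrite divr_ge0 // ltW|exact: ltW].
have h2 : (2 * t)^-1 * L <= d / 2.
  rewrite /t; have -> : (2 * ((L + 1) / d))^-1 * L = d / 2 * (L / (L + 1)).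
    by field; rewrite !gt_eqF // ltr_wpDl.
  by rewrite ler_piMr ?divr_ge0 ?(ltW d0) // ler_pdivrMr ?mul1r ?lerDl // ltr_wpDl.
by lra.
Qed.

End orthogonality.

(** * Normal equations and the error functional *)

Section minimal_pairs.
Context {R : realType}.
Implicit Types f g : R -> R.

Lemma measurable_inve_sum f g : spectral_density f -> spectral_density g ->
  measurable_fun circle (fun x => (((f x + g x)%:E)^-1)%E).
Proof.
move=> [mf f0 _] [mg g0 _].
have p0 x : circle x -> 0 <= f x + g x by move=> cx; rewrite addr_ge0 ?f0 ?g0.
have mp : measurable_fun circle (fun x => f x + g x) by exact: measurable_funD.
have miv := measurable_fun_invr measurable_circle mp p0.
have -> : (fun x => (((f x + g x)%:E)^-1)%E) =
    (fun x => if f x + g x == 0 then +oo%E else ((f x + g x)^-1)%:E).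
  by apply/funext => x; rewrite inver.
apply: measurable_fun_if => //.
- exact: measurable_fun_eqr.
- apply: (@measurable_funS _ _ _ _ circle) => //.
  exact/measurable_EFinP.
Qed.

Lemma minimality_positive f g : spectral_density f -> spectral_density g ->
  minimality f g ->
  ae_circle (fun x => 0 < f x + g x) /\ rint (fun x => (f x + g x)^-1).
Proof.
move=> sf sg fin; have mI := measurable_inve_sum sf sg.
have [mf f0 _] := sf; have [mg g0 _] := sg.
have p0 x : circle x -> 0 <= f x + g x by move=> cx; rewrite addr_ge0 ?f0 ?g0.
have mp : measurable_fun circle (fun x => f x + g x) by exact: measurable_funD.
have miv := measurable_fun_invr measurable_circle mp p0.
have I0 x : circle x -> (0 <= ((f x + g x)%:E)^-1)%E.
  by move=> cx; rewrite inve_ge0 lee_fin p0.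
have iI : (@lebesgue_measure R).-integrable circle (fun x => (((f x + g x)%:E)^-1)%E).
  apply/integrableP; split => //; apply: le_lt_trans fin.
  rewrite le_eqVlt; apply/orP; left; apply/eqP.
  by apply: eq_integral => x /set_mem cx; rewrite gee0_abs ?I0.
split.
  (* An integrable function is finite almost everywhere, and the extended inverse is +oo where f + g
     = 0. *)
  have := integrable_ae measurable_circle iI.
  apply: ae_circleS => x cx; rewrite inver; case: eqP => // /eqP pn _.
  by rewrite lt_neqAle eq_sym pn p0.
apply/integrableP; split; first exact/measurable_EFinP.
apply: le_lt_trans fin; apply: ge0_le_integral => //.
  by apply: measurableT_comp => //; exact/measurable_EFinP.
move=> x cx; rewrite /= ger0_norm ?invr_ge0 ?p0 // inver.
by case: eqP => // _; rewrite leey.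
Qed.

(** Raising the densities of a minimal pair keeps it among the competitors of the optimization
    problem. *)
Lemma minimality_le f0 g0 f g : spectral_density f0 -> spectral_density g0 ->
  spectral_density f -> spectral_density g ->
  (forall x, circle x -> f0 x + g0 x <= f x + g x) ->
  minimality f0 g0 -> minimality f g.
Proof.
move=> sf0 sg0 sf sg le; apply: le_lt_trans; apply: ge0_le_integral => //.
- move=> x cx; rewrite inve_ge0 lee_fin addr_ge0 //.
    by case: sf => _ + _; apply.
  by case: sg => _ + _; apply.
- exact: measurable_inve_sum.
- exact: measurable_inve_sum.
- move=> x cx; rewrite lee_pV2 ?inE ?lee_fin ?le //.
    by case: sf => _ pf _; case: sg => _ pg _; rewrite addr_ge0 ?pf ?pg.
  by case: sf0 => _ pf _; case: sg0 => _ pg _; rewrite addr_ge0 ?pf ?pg.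
Qed.

Lemma rint_ratio f g : spectral_density f -> spectral_density g ->
  rint (fun x => f x / (f x + g x)).
Proof.
move=> [mf f0 _] [mg g0 _].
have p0 x : circle x -> 0 <= f x + g x by move=> cx; rewrite addr_ge0 ?f0 ?g0.
apply: (@rint_bounded _ _ 1).
  by apply: measurable_funM => //; apply: measurable_fun_invr => //; exact: measurable_funD.
apply: ae_circleW => x cx; rewrite ger0_norm ?divr_ge0 ?p0 ?f0 //.
have [->|pn] := eqVneq (f x + g x) 0; first by rewrite invr0 mulr0.
by rewrite ler_pdivrMr ?mul1r ?lerDl ?g0 // lt_neqAle eq_sym pn p0.
Qed.

Lemma rint_harmonic f g : spectral_density f -> spectral_density g ->
  rint (fun x => f x * g x / (f x + g x)).
Proof.
move=> sf sg; have [mf f0 _] := sf; have [mg g0 ig] := sg.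
have ir := rint_ratio sf sg.
apply: (@rint_le _ _ g) => //.
  apply: measurable_funM; first exact: measurable_funM.
  apply: measurable_fun_invr => //; first exact: measurable_funD.
  by move=> x cx; rewrite addr_ge0 ?f0 ?g0.
apply: ae_circleW => x cx; rewrite ger0_norm; last first.
  by rewrite divr_ge0 ?mulr_ge0 ?addr_ge0 ?f0 ?g0.
have [->|pn] := eqVneq (f x + g x) 0; first by rewrite invr0 mulr0 g0.
have pp : 0 < f x + g x by rewrite lt_neqAle eq_sym pn addr_ge0 ?f0 ?g0.
by rewrite ler_pdivrMr // mulrC ler_wpM2l ?g0 // lerDl g0.
Qed.

End minimal_pairs.

(** * Toeplitz matrices as Gram matrices *)

Section toeplitz_forms.
Context {R : realType}.
Variable N : nat.
Implicit Types (x y c : 'cV[R[i]]_N.+1) (psi : R -> R).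

(** Entry (j, k) is the product of e^(i k t) and e^(i j t) in L_2(psi), so the matrix represents the
    Hermitian form of L_2(psi) on polynomials. *)
Lemma dotc_toeplitz psi x y : rint psi ->
  dotc (toeplitz N psi *m x) y =
  cmean (fun t => trigpoly x t * conjc (trigpoly y t) * (psi t)%:C).
Proof.
move=> ip.
have -> : (fun t => trigpoly x t * conjc (trigpoly y t) * (psi t)%:C) =
  (fun t => \sum_(j < N.+1) \sum_(k < N.+1)
     x k 0 * conjc (y j 0) * (expi (- (j%:Z - k%:Z)) t * (psi t)%:C)).
  apply/funext => t; rewrite conj_trigpoly mulr_sumr mulr_suml; apply: eq_bigr => j _.
  rewrite mulrAC /trigpoly !mulr_suml; apply: eq_bigr => k _.
  by rewrite opprB expiD; ring.
have ii j k : cint (fun t => x k 0 * conjc (y j 0) *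
                             (expi (- (j%:Z - k%:Z)) t * (psi t)%:C)).
  by apply: cintZ; exact: cint_expi_mul.
rewrite cmean_sum; last by move=> j; apply: cint_sum => k; exact: ii.
apply: eq_bigr => j _; rewrite cmean_sum; last by move=> k; exact: ii.
rewrite mxE mulr_suml; apply: eq_bigr => k _.
rewrite cmeanZ; last exact: cint_expi_mul.
by rewrite mxE mulrAC [RHS]mulrC mulrA mulrAC [_ * x k 0]mulrC.
Qed.

Lemma Re_dotc_toeplitz psi x y : rint psi ->
  complex.Re (dotc (toeplitz N psi *m x) y) =
  rmean (fun t => dotr (trigpoly x t) (trigpoly y t) * psi t).
Proof.
move=> ip; rewrite dotc_toeplitz // cmeanE /=; apply: eq_rmean => t _.
by rewrite Re_mul Re_mulJ /= mulr0 subr0.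
Qed.

Lemma rint_dotr_trigpoly psi x y : rint psi ->
  rint (fun t => dotr (trigpoly x t) (trigpoly y t) * psi t).
Proof.
move=> ip; have [mx [M HM]] := cbounded_trigpoly x.
have [my [K HK]] := cbounded_trigpoly y.
apply: (@rint_mul_bounded _ _ _ (1 / 2 * M + K / 1 / 2)) => //.
  exact: measurable_dotr.
apply: ae_circleW => t ct; apply: le_trans (norm_dotr_le _ _ ltr01) _.
by have := HM t ct; have := HK t ct; lra.
Qed.

Lemma rint_sqmod_trigpoly psi x : rint psi ->
  rint (fun t => sqmod (trigpoly x t) * psi t).
Proof. by move=> ip; have := rint_dotr_trigpoly x x ip; under eq_fun do rewrite dotrr. Qed.

(** The form is definite: a kernel vector gives a polynomial of norm 0 in L_2(psi), hence zero
    almost everywhere, and Parseval's identity annihilates its coefficients. The transposes adapt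
    this to row freeness. *)
Lemma toeplitz_unit psi : rint psi -> ae_circle (fun t => 0 < psi t) ->
  toeplitz N psi \in unitmx.
Proof.
move=> ip p0; rewrite -unitmx_tr -row_free_unit; apply: inj_row_free => v vT.
have Tx : toeplitz N psi *m v^T = 0.
  by apply: (can_inj (@trmxK _ _ _)); rewrite trmx_mul trmxK vT trmx0.
have := Re_dotc_toeplitz v^T v^T ip.
rewrite Tx /dotc big1 ?raddf0; last by move=> k _; rewrite mxE mul0r.
set u := v^T => m0.
have {}m0 : rmean (fun t => sqmod (trigpoly u t) * psi t) = 0.
  by rewrite [RHS]m0; apply: eq_rmean => t _; rewrite dotrr.
have iu : rint (fun t => sqmod (trigpoly u t) * psi t) by exact: rint_sqmod_trigpoly.
have z := rmean_le0_ae iu _ _.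
have {}z : ae_circle (fun t => sqmod (trigpoly u t) * psi t = 0).
  apply: z; last by rewrite m0.
  by apply: ae_circleS p0 => t _ pt; rewrite mulr_ge0 ?sqmod_ge0 ?ltW.
have s0 : rmean (fun t => sqmod (trigpoly u t)) = 0.
  rewrite -[RHS](rmean_cst (0 : R)); apply: ae_eq_rmean.
  - have := rint_sqmod_trigpoly u (rint_cst 1).
    by under eq_fun do rewrite /= mulr1.
  - exact: rint_cst.
  - apply: ae_circleS2 z p0 => t _ /eqP; rewrite mulf_eq0 => /orP[/eqP //|/eqP ->].
    by rewrite ltxx.
move: s0; rewrite rmean_sqmod_trigpoly => /eqP.
rewrite psumr_eq0; last by move=> k _; exact: sqmod_ge0.
move=> /allP s0; apply: (can_inj (@trmxK _ _ _)); rewrite trmx0 -/u.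
apply/matrixP => k j; rewrite !ord1 [RHS]mxE; apply: sqmod_eq0; apply/eqP.
by apply: (s0 k); rewrite mem_index_enum.
Qed.

End toeplitz_forms.

(** * Dual representation of the error *)

Section error_functional_bound.
Context {R : realType}.
Variable N : nat.
Variables (a : 'cV[R[i]]_N.+1) (f g : R -> R).
Hypotheses (sf : spectral_density f) (sg : spectral_density g)
  (fg : minimality f g).
Implicit Types c : 'cV[R[i]]_N.+1.

Let coefC : 'cV[R[i]]_N.+1 := invmx (Bmx N f g) *m (Rmx N f g *m a).

Lemma Bmx_coefC : Bmx N f g *m coefC = Rmx N f g *m a.
Proof.
have [pp iv] := minimality_positive sf sg fg.
rewrite /coefC mulmxA mulmxV ?mul1mx //; apply: toeplitz_unit => //.
by apply: ae_circleS pp => x _ px; rewrite invr_gt0.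
Qed.

Lemma normal_equations c :
  rmean (fun x => dotr (trigpoly a x) (trigpoly c x) * (f x / (f x + g x))) =
  rmean (fun x => dotr (Cpoly a f g x) (trigpoly c x) * (f x + g x)^-1).
Proof.
have [_ iv] := minimality_positive sf sg fg.
rewrite -(Re_dotc_toeplitz a c (rint_ratio sf sg)) -/(Rmx N f g) -Bmx_coefC.
by rewrite Re_dotc_toeplitz.
Qed.

(* The error of the interpolation is the supremum over c of the mean of this
   density, which at each point is concave and nondecreasing in (f, g). *)
Definition dual_density c (f g : R -> R) (x : R) : R :=
  sqmod (trigpoly a x) * (f x * g x / (f x + g x))
  + 2 * (dotr (trigpoly a x) (trigpoly c x) * (f x / (f x + g x)))
  - sqmod (trigpoly c x) * (f x + g x)^-1.

Lemma rint_dual_density c : rint (dual_density c f g).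
Proof.
have [_ iv] := minimality_positive sf sg fg.
apply: rintB; last exact: rint_sqmod_trigpoly.
apply: rintD; first exact/rint_sqmod_trigpoly/rint_harmonic.
by apply: rintZ; apply: rint_dotr_trigpoly; exact: rint_ratio.
Qed.

(** Testing the normal equations against C itself turns the form in the inverse of [Bmx] into the
    mean of |C|^2 / (f + g). *)
Lemma Re_error_functional :
  complex.Re (error_functional a f g) =
  rmean (fun x => sqmod (trigpoly a x) * (f x * g x / (f x + g x))) +
  rmean (fun x => sqmod (Cpoly a f g x) * (f x + g x)^-1).
Proof.
rewrite /error_functional Re_add addrC -/coefC; congr (_ + _).
  rewrite Re_dotc_toeplitz; last exact: rint_harmonic.
  by apply: eq_rmean => x _; rewrite dotrr.
rewrite Re_dotc_toeplitz; last exact: rint_ratio.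
by rewrite normal_equations; apply: eq_rmean => x _; rewrite dotrr.
Qed.

(** Completing the square in [c]: the normal equations replace the cross term by the product of C
    and [trigpoly c] in L_2(1 / (f + g)). The supremum over [c] is therefore attained at C. *)
Lemma rmean_dual_density c :
  rmean (dual_density c f g) = complex.Re (error_functional a f g) -
  rmean (fun x => sqmod (Cpoly a f g x - trigpoly c x) * (f x + g x)^-1).
Proof.
have [_ iv] := minimality_positive sf sg fg.
have i1 := rint_sqmod_trigpoly a (rint_harmonic sf sg).
have i2 := rint_dotr_trigpoly a c (rint_ratio sf sg).
have i3 := rint_sqmod_trigpoly c iv.
have i4 : rint (fun x => dotr (Cpoly a f g x) (trigpoly c x) * (f x + g x)^-1).
  exact: rint_dotr_trigpoly.
have i5 : rint (fun x => sqmod (Cpoly a f g x) * (f x + g x)^-1).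
  exact: rint_sqmod_trigpoly.
have E : rmean (fun x => sqmod (Cpoly a f g x - trigpoly c x) * (f x + g x)^-1) =
    rmean (fun x => sqmod (Cpoly a f g x) * (f x + g x)^-1
       - 2 * (dotr (Cpoly a f g x) (trigpoly c x) * (f x + g x)^-1)
       + sqmod (trigpoly c x) * (f x + g x)^-1).
  by apply: eq_rmean => x _; rewrite !sqmodE /dotr !ReImE; ring.
rewrite {}E (rmeanD (rintB i5 (rintZ 2 i4)) i3) (rmeanB i5 (rintZ 2 i4)) (rmeanZ 2 i4).
rewrite -normal_equations Re_error_functional /dual_density.
rewrite (rmeanB (rintD i1 (rintZ 2 i2)) i3) (rmeanD i1 (rintZ 2 i2)) (rmeanZ 2 i2).
by ring.
Qed.

Lemma rmean_dual_density_le c :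
  rmean (dual_density c f g) <= complex.Re (error_functional a f g).
Proof.
have [pp iv] := minimality_positive sf sg fg.
rewrite rmean_dual_density gerBl; apply: rmean_ge0.
  apply: rint_sqmod_mul => //; apply: cboundedB; exact: cbounded_trigpoly.
by apply: ae_circleS pp => x _ px; rewrite mulr_ge0 ?sqmod_ge0 ?invr_ge0 ?ltW.
Qed.

Lemma rmean_dual_density_eq :
  rmean (dual_density coefC f g) = complex.Re (error_functional a f g).
Proof.
rewrite rmean_dual_density (_ : rmean (fun x => sqmod _ * _) = 0) ?subr0 //.
rewrite -[RHS](rmean_cst (0 : R)); apply: eq_rmean => x _.
by rewrite subrr sqmodE /= expr0n addr0 mul0r.
Qed.

Lemma hopt_orthogonal c : rmean (fun x => dotr (hopt a f g x) (trigpoly c x)) = 0.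
Proof.
have [_ iv] := minimality_positive sf sg fg.
have i2 := rint_dotr_trigpoly a c (rint_ratio sf sg).
have i4 : rint (fun x => dotr (Cpoly a f g x) (trigpoly c x) * (f x + g x)^-1).
  exact: rint_dotr_trigpoly.
have -> : rmean (fun x => dotr (hopt a f g x) (trigpoly c x)) =
    rmean (fun x => dotr (trigpoly a x) (trigpoly c x) * (f x / (f x + g x))
                  - dotr (Cpoly a f g x) (trigpoly c x) * (f x + g x)^-1).
  by apply: eq_rmean => x _; rewrite /hopt /dotr !ReImE /=; ring.
by rewrite rmeanB // normal_equations subrr.
Qed.

Lemma sqmod_hopt x : sqmod (hopt a f g x) = hfun_g a f g x.
Proof. by rewrite sqmod_divr. Qed.

Lemma sqmod_sub_hopt x : 0 < f x + g x ->
  sqmod (trigpoly a x - hopt a f g x) = hfun_f a f g x.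
Proof.
move=> px; rewrite /hfun_f /hnum_f -sqmod_divr; congr sqmod.
by apply: complex_ext; rewrite /hopt !ReImE /=; field; rewrite gt_eqF.
Qed.

Lemma cmeasurable_hopt : cmeasurable (hopt a f g).
Proof.
have [mf f0 _] := sf; have [mg g0 _] := sg.
apply: cmeasurable_divr.
- apply: cmeasurableB; last exact: cmeasurable_trigpoly.
  by apply: cmeasurableM; [exact: cmeasurable_trigpoly|exact: cmeasurable_real].
- exact: measurable_funD.
- by move=> x cx; rewrite addr_ge0 ?f0 ?g0.
Qed.

End error_functional_bound.

(** * Optimality of h(f, g) *)

Section optimality.
Context {R : realType}.
Variable N : nat.
Variables (a : 'cV[R[i]]_N.+1) (f g : R -> R).
Hypotheses (sf : spectral_density f) (sg : spectral_density g)
  (fg : minimality f g) (bh : ae_bounded (hfun_g a f g)).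

Lemma spectral_densityD (u v : R -> R) : spectral_density u -> spectral_density v ->
  rint (u \+ v) /\ forall x, circle x -> 0 <= (u \+ v) x.
Proof.
move=> [_ u0 iu] [_ v0 iv]; split; first exact: rintD.
by move=> x cx; rewrite addr_ge0 ?u0 ?v0.
Qed.

Lemma hopt_ae_bounded : exists M : R, ae_circle (fun x => sqmod (hopt a f g x) <= M).
Proof.
have [M HM] := bh; exists M; apply: ae_circleS HM => x _; apply: le_trans.
by rewrite sqmod_hopt ler_norm.
Qed.

Lemma L2N_hopt (u v : R -> R) : spectral_density u -> spectral_density v ->
  L2N N (u \+ v) (hopt a f g).
Proof.
move=> su sv; have [iw w0] := spectral_densityD su sv.
have [M HM] := hopt_ae_bounded.
apply: L2N_bounded HM _ => //; first exact: cmeasurable_hopt.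
by move=> c; exact: hopt_orthogonal.
Qed.

Lemma rint_sqmod_hopt (u : R -> R) : spectral_density u ->
  rint (fun x => sqmod (hopt a f g x) * u x).
Proof.
move=> [_ _ iu]; have [M HM] := hopt_ae_bounded.
apply: (@rint_mul_bounded _ _ _ M) iu; first by apply: measurable_sqmod; apply: cmeasurable_hopt.
by apply: ae_circleS HM => x _ hx; rewrite ger0_norm ?sqmod_ge0.
Qed.

Lemma rint_sqmod_sub_hopt (u : R -> R) : spectral_density u ->
  rint (fun x => sqmod (trigpoly a x - hopt a f g x) * u x).
Proof.
move=> [_ _ iu]; have [M HM] := hopt_ae_bounded.
have [K HK] := trigpoly_bounded a.
apply: (@rint_mul_bounded _ _ _ (2 * K + 2 * M)) iu.
  apply: measurable_sqmod; apply: cmeasurableB; first exact: cmeasurable_trigpoly.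
  exact: cmeasurable_hopt.
apply: ae_circleS HM => x _ hx; rewrite ger0_norm ?sqmod_ge0 //.
apply: le_trans (sqmodD_le _ _) _.
by rewrite sqmodN lerD // ler_pM2l ?HK.
Qed.

Lemma Delta_hopt (u v : R -> R) : spectral_density u -> spectral_density v ->
  Delta a (hopt a f g) u v =
  (rmean (fun x => sqmod (trigpoly a x - hopt a f g x) * u x) +
   rmean (fun x => sqmod (hopt a f g x) * v x))%:E.
Proof.
move=> su sv; rewrite /Delta emean_rmean; last exact: rint_sqmod_sub_hopt.
by rewrite emean_rmean //; exact: rint_sqmod_hopt.
Qed.

Lemma hopt_spectral_characteristic : spectral_characteristic a f g (hopt a f g).
Proof.
split; first exact: L2N_hopt.
move=> h Lh; rewrite Delta_hopt //.
have [iw w0] := spectral_densityD sf sg.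
have [pp iv] := minimality_positive sf sg fg.
have [mf f0 If] := sf; have [mg g0 Ig] := sg.
have [mr mi hfin _] := Lh.
have mh : cmeasurable h by [].
have iw2 : rint (fun x => sqmod (h x) * (f x + g x)).
  apply: rint_emean hfin.
    by apply: measurable_funM; [exact: measurable_sqmod|exact: rint_measurable].
  by move=> x cx; rewrite mulr_ge0 ?sqmod_ge0 ?addr_ge0 ?f0 ?g0.
have ig : rint (fun x => sqmod (h x) * g x).
  apply: rint_le iw2; first by apply: measurable_funM => //; exact: measurable_sqmod.
  apply: ae_circleW => x cx; rewrite ger0_norm ?(mulr_ge0 (sqmod_ge0 _)) ?g0 //.
  by rewrite ler_wpM2l ?sqmod_ge0 // lerDr f0.
have [K HK] := trigpoly_bounded a.
have jf : rint (fun x => sqmod (trigpoly a x - h x) * f x).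
  apply: (@rint_le _ _ (fun x => 2 * K * f x + 2 * (sqmod (h x) * (f x + g x)))).
  - apply: measurable_funM => //; apply: measurable_sqmod.
    by apply: cmeasurableB => //; exact: cmeasurable_trigpoly.
  - apply: ae_circleW => x cx; rewrite ger0_norm ?(mulr_ge0 (sqmod_ge0 _)) ?f0 //.
    have h1 := ler_wpM2r (f0 x cx) (sqmodD_le (trigpoly a x) (- h x)).
    apply: le_trans h1 _; rewrite sqmodN mulrDl lerD //.
      by rewrite ler_wpM2r ?f0 // ler_pM2l ?HK.
    by rewrite -mulrA ler_pM2l // ler_wpM2l ?sqmod_ge0 // lerDl g0.
  - by apply: rintD; exact: rintZ.
rewrite /Delta !emean_rmean // -EFinD lee_fin.
pose C := Cpoly a f g.
have [ic mc] := L2N_orthogonal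
  (invmx (Bmx N f g) *m (Rmx N f g *m a)) iw w0 pp iv Lh.
have [ic0 mc0] := L2N_orthogonal
  (invmx (Bmx N f g) *m (Rmx N f g *m a)) iw w0 pp iv (L2N_hopt sf sg).
rewrite -/C in ic mc ic0 mc0.
have ih1 := rint_sqmod_sub_hopt sf; have ih2 := rint_sqmod_hopt sg.
have icc := rintB ic ic0.
(* Both [h] and h(f, g) are orthogonal to C, so this cross term can be added for free; it makes the
   difference of the integrands a square at each point. *)
have m0 : 2 * rmean (fun x => dotr (h x) (C x) - dotr (hopt a f g x) (C x)) = 0.
  by rewrite (rmeanB ic ic0) mc mc0 subrr mulr0.
rewrite -(rmeanD ih1 ih2) -(rmeanD jf ig) -[leRHS]addr0 -m0.
rewrite -(rmeanZ 2 icc) -[leRHS]rmeanD; [|exact: rintD|exact: rintZ].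
apply: le_rmean; [exact: rintD|by apply: rintD; [exact: rintD|exact: rintZ]|].
(* Completing the square: the two sides differ by |h - h(f,g)|^2 (f + g). *)
apply: ae_circleS pp => x cx px; rewrite -subr_ge0.
have -> : sqmod (trigpoly a x - h x) * f x + sqmod (h x) * g x +
    2 * (dotr (h x) (C x) - dotr (hopt a f g x) (C x)) -
    (sqmod (trigpoly a x - hopt a f g x) * f x + sqmod (hopt a f g x) * g x) =
    sqmod (h x - hopt a f g x) * (f x + g x).
  rewrite !sqmodE /dotr /C /hopt !ReImE /=; field.
  by rewrite gt_eqF.
by rewrite mulr_ge0 ?sqmod_ge0 ?ltW.
Qed.

End optimality.

(** * The saddle point *)

Section perturbation.
Context {R : realType}.
Implicit Types u v : R -> R.

(* At each point the one of u, 2 v - u that is at least u: at the same distance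
   from v as u. *)
Definition raise v u (x : R) : R := u x + 2 * Num.max (v x - u x) 0.

Lemma raise_ge v u x : u x <= raise v u x.
Proof. by rewrite /raise lerDl mulr_ge0 // le_max lexx orbT. Qed.

Lemma norm_raise v u x : `|raise v u x - v x| = `|u x - v x|.
Proof.
rewrite /raise; case: (leP (v x - u x) 0) => h; first by rewrite mulr0 addr0.
by rewrite -normrN; congr (`|_|); ring.
Qed.

Lemma spectral_density_raise v u : spectral_density v -> spectral_density u ->
  spectral_density (raise v u).
Proof.
move=> [mv v0 iv] [mu u0 iu].
have iuv : rint (fun x => v x - u x) by exact: rintB.
have mr : measurable_fun circle (raise v u).
  apply: measurable_funD => //; apply: measurable_funM => //.
  by apply: measurable_maxr => //; exact: measurable_funB.
split => //.
  by move=> x cx; rewrite (le_trans (u0 x cx)) // raise_ge.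
apply: (@rint_le _ _ (fun x => u x + 2 * `|v x - u x|)) => //.
  apply: ae_circleW => x cx; rewrite ger0_norm.
    by rewrite lerD2l ler_pM2l // ge_max ler_norm normr_ge0.
  by rewrite (le_trans (u0 x cx)) // raise_ge.
by apply: rintD => //; apply: rintZ; exact: rint_norm.
Qed.

End perturbation.

Section dual_density_increments.
Context {R : realType}.
Variables (N : nat) (a c : 'cV[R[i]]_N.+1).

(** At each point the density is fractional linear in f with denominator f + g, so an increment is
    f' - f times a determinant over the product of the denominators; the determinant is |A g +
    c|^2. *)
Lemma dual_density_incr_f (f f' g : R -> R) x : 0 < f x + g x -> f x <= f' x ->
  dual_density a c f' g x - dual_density a c f g x =
  (f' x - f x) * sqmod (trigpoly a x * (g x)%:C + trigpoly c x)
  / ((f' x + g x) * (f x + g x)).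
Proof.
move=> p0 ff'; have p1 : 0 < f' x + g x by apply: lt_le_trans p0 _; rewrite lerD2r.
rewrite /dual_density !sqmodE /dotr !ReImE /=; field.
by rewrite !gt_eqF.
Qed.

(** The same computation in the variable g, where the determinant is |A f - c|^2. *)
Lemma dual_density_incr_g (f g g' : R -> R) x : 0 < f x + g x -> g x <= g' x ->
  dual_density a c f g' x - dual_density a c f g x =
  (g' x - g x) * sqmod (trigpoly a x * (f x)%:C - trigpoly c x)
  / ((f x + g' x) * (f x + g x)).
Proof.
move=> p0 gg'; have p1 : 0 < f x + g' x by apply: lt_le_trans p0 _; rewrite lerD2l.
rewrite /dual_density !sqmodE /dotr !ReImE /=; field.
by rewrite !gt_eqF.
Qed.

End dual_density_increments.

(** * Signs of the multipliers and the saddle inequalities *)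

Section saddle_point.
Context {R : realType}.
Variables (N : nat) (a : 'cV[R[i]]_N.+1) (f0 g0 : R -> R).
Hypotheses (sf0 : spectral_density f0) (sg0 : spectral_density g0)
  (hmin : minimality f0 g0).

Let c0 : 'cV[R[i]]_N.+1 := invmx (Bmx N f0 g0) *m (Rmx N f0 g0 *m a).

(** The mean of the dual density at (f, g) is at most the error there, which is at most the error at
    (f0, g0), which equals the mean of the dual density at (f0, g0) for this very [c0]. A
    nonnegative increment thus has mean at most 0. *)
Lemma dual_density_stationary (D : set ((R -> R) * (R -> R))) f g :
  solves_optimization a D f0 g0 -> D (f, g) ->
  spectral_density f -> spectral_density g ->
  (forall x, circle x -> f0 x <= f x) -> (forall x, circle x -> g0 x <= g x) ->
  ae_circle (fun x => 0 <= dual_density a c0 f g x - dual_density a c0 f0 g0 x) ->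
  ae_circle (fun x => dual_density a c0 f g x - dual_density a c0 f0 g0 x = 0).
Proof.
move=> [_ ub] Dfg sf sg ff gg mono.
have mfg : minimality f g.
  by apply: minimality_le hmin => // x cx; rewrite lerD ?ff ?gg.
have : error_functional a f g <= error_functional a f0 g0.
  by apply: ub; exists (f, g).
rewrite lecE => /andP[_ le].
have i1 := rint_dual_density a sf sg mfg c0.
have i2 := rint_dual_density a sf0 sg0 hmin c0.
apply: rmean_le0_ae => //; first exact: rintB.
rewrite rmeanB // subr_le0 (rmean_dual_density_eq a sf0 sg0 hmin).
by apply: le_trans le; exact: rmean_dual_density_le.
Qed.

Lemma multiplier_f_ge0 (eps1 alpha1 : R) (f1 : R -> R) (G : set (R -> R)) :
  0 < eps1 -> spectral_density f1 -> D2 eps1 f1 f0 -> G g0 ->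
  emean (fun x => `|f0 x - f1 x| ^+ 2) = eps1%:E ->
  ae_circle (fun x =>
    hnum_f a f0 g0 x = (f0 x + g0 x) ^+ 2 * (f0 x - f1 x) * alpha1) ->
  solves_optimization a (D2 eps1 f1 `*` G) f0 g0 ->
  0 <= alpha1.
Proof.
move=> e1 sf1 Df0 Gg0 eqe eqf opt; rewrite leNgt; apply/negP => a1.
have sr := spectral_density_raise sf1 sf0.
have [pp _] := minimality_positive sf0 sg0 hmin.
have Dr : (D2 eps1 f1 `*` G) (raise f1 f0, g0).
  split => //=; split => //; case: Df0 => _; apply: le_trans.
  rewrite le_eqVlt; apply/orP; left; apply/eqP; congr emean.
  by apply/funext => x; rewrite norm_raise.
have ge x : circle x -> f0 x <= raise f1 f0 x by move=> _; exact: raise_ge.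
have incr : ae_circle (fun x =>
    0 <= dual_density a c0 (raise f1 f0) g0 x - dual_density a c0 f0 g0 x).
  apply: ae_circleS pp => x cx px; rewrite dual_density_incr_f ?ge //.
  apply: divr_ge0; first by rewrite (mulr_ge0 _ (sqmod_ge0 _)) // subr_ge0 ge.
  by rewrite (mulr_ge0 _ (ltW px)) // (le_trans (ltW px)) // lerD2r ge.
have z := dual_density_stationary opt Dr sr sg0 ge (fun _ _ => lexx _) incr.
(* A zero increment means either that nothing was raised, so f1 <= f0, or that the numerator
   vanishes, so f0 = f1 by the system. As alpha1 < 0 gives f0 <= f1, both cases end in f0 = f1,
   against [0 < eps1]. *)
have e0 : ae_circle (fun x => `|f0 x - f1 x| ^+ 2 = 0).
  apply: ae_circleS3 z pp eqf => x cx zx px ex.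
  have p2 : 0 < (f0 x + g0 x) ^+ 2 by rewrite exprn_gt0.
  have h0 : 0 <= hnum_f a f0 g0 x by exact: sqmod_ge0.
  have le : f0 x <= f1 x.
    rewrite ex -mulrA pmulr_rge0 // nmulr_lge0 // in h0.
    by rewrite -subr_le0.
  suff -> : f0 x = f1 x by rewrite subrr normr0 expr0n.
  have qx : raise f1 f0 x + g0 x != 0.
    by rewrite gt_eqF // (lt_le_trans px) // lerD2r ge.
  move: zx; rewrite dual_density_incr_f ?ge // => /eqP.
  have Dn : (raise f1 f0 x + g0 x) * (f0 x + g0 x) != 0 by rewrite mulf_neq0 // gt_eqF.
  rewrite -[trigpoly c0 x]/(Cpoly a f0 g0 x) -/(hnum_f a f0 g0 x) ex.
  rewrite mulf_eq0 invr_eq0 (negbTE Dn) orbF mulf_eq0 => /orP[].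
    rewrite /raise addrC addKr mulf_eq0 pnatr_eq0 /= => /eqP m0.
    apply/eqP; rewrite eq_le le /= -subr_le0 -m0.
    by rewrite le_max lexx.
  rewrite (mulf_eq0 _ alpha1) (lt_eqF a1) orbF (mulf_eq0 _ (f0 x - f1 x)).
  by rewrite (gt_eqF p2) /= subr_eq0 => /eqP.
have [mf0 _ _] := sf0; have [mf1 _ _] := sf1.
have iq : rint (fun x => `|f0 x - f1 x| ^+ 2).
  apply: rint_emean; last by rewrite eqe ltry.
    by apply: measurable_funX; apply: measurableT_comp => //; exact: measurable_funB.
  by move=> x _; rewrite exprn_ge0.
move: eqe; rewrite emean_rmean // (ae_eq_rmean iq (rint_cst 0) e0) rmean_cst.
by move=> -[e10]; rewrite -e10 ltxx in e1.
Qed.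

Lemma multiplier_g_ge0 (eps2 alpha2 : R) (g1 Psi : R -> R) (F : set (R -> R)) :
  0 < eps2 -> spectral_density g1 -> D1 eps2 g1 g0 -> F f0 ->
  emean (fun x => `|g0 x - g1 x|) = eps2%:E ->
  ae_circle (fun x => g0 x != g1 x -> Psi x = Num.sg (g0 x - g1 x)) ->
  ae_circle (fun x =>
    hnum_g a f0 g0 x = (f0 x + g0 x) ^+ 2 * Psi x * alpha2) ->
  solves_optimization a (F `*` D1 eps2 g1) f0 g0 ->
  0 <= alpha2.
Proof.
move=> e2 sg1 Dg0 Ff0 eqe hPsi eqg opt; rewrite leNgt; apply/negP => a2.
have sr := spectral_density_raise sg1 sg0.
have [pp _] := minimality_positive sf0 sg0 hmin.
have Dr : (F `*` D1 eps2 g1) (f0, raise g1 g0).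
  split => //=; split => //; case: Dg0 => _; apply: le_trans.
  rewrite le_eqVlt; apply/orP; left; apply/eqP; congr emean.
  by apply/funext => x; rewrite norm_raise.
have ge x : circle x -> g0 x <= raise g1 g0 x by move=> _; exact: raise_ge.
have incr : ae_circle (fun x =>
    0 <= dual_density a c0 f0 (raise g1 g0) x - dual_density a c0 f0 g0 x).
  apply: ae_circleS pp => x cx px; rewrite dual_density_incr_g ?ge //.
  apply: divr_ge0; first by rewrite (mulr_ge0 _ (sqmod_ge0 _)) // subr_ge0 ge.
  by rewrite (mulr_ge0 _ (ltW px)) // (le_trans (ltW px)) // lerD2l ge.
have z := dual_density_stationary opt Dr sf0 sr (fun _ _ => lexx _) ge incr.
have hP : ae_circle (fun x => hnum_g a f0 g0 x = (f0 x + g0 x) ^+ 2 * Psi x * alpha2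
    /\ (g0 x != g1 x -> Psi x = Num.sg (g0 x - g1 x))).
  by apply: ae_circleS2 eqg hPsi => x _.
(* Where g0 and g1 differ, alpha2 < 0 forces Psi = -1 and g0 < g1. Then g0 is strictly raised and
   the numerator is nonzero, so the increment could not vanish. *)
have e0 : ae_circle (fun x => `|g0 x - g1 x| = 0).
  apply: ae_circleS3 z pp hP => x cx zx px [ex Px].
  apply/eqP; rewrite normr_eq0 subr_eq0; apply: contraT => ne.
  have {}Px := Px ne.
  have p2 : 0 < (f0 x + g0 x) ^+ 2 by rewrite exprn_gt0.
  have h0 : 0 <= hnum_g a f0 g0 x by exact: sqmod_ge0.
  have Pn : Psi x != 0 by rewrite Px sgr_eq0 subr_eq0.
  have lt : g0 x < g1 x.
    rewrite ex -mulrA pmulr_rge0 // nmulr_lge0 // Px sgr_le0 subr_le0 in h0.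
    by rewrite lt_neqAle ne h0.
  have qx : f0 x + raise g1 g0 x != 0.
    by rewrite gt_eqF // (lt_le_trans px) // lerD2l ge.
  move: zx; rewrite dual_density_incr_g ?ge // => /eqP.
  have Dn : (f0 x + raise g1 g0 x) * (f0 x + g0 x) != 0 by rewrite mulf_neq0 // gt_eqF.
  rewrite -[trigpoly c0 x]/(Cpoly a f0 g0 x) -/(hnum_g a f0 g0 x) ex.
  rewrite mulf_eq0 invr_eq0 (negbTE Dn) orbF mulf_eq0 => /orP[].
    rewrite /raise addrC addKr mulf_eq0 pnatr_eq0 /= => /eqP m0.
    have : g1 x - g0 x <= 0 by rewrite -m0 le_max lexx.
    by rewrite subr_le0 leNgt lt.
  by rewrite (mulf_eq0 _ alpha2) (lt_eqF a2) (mulf_eq0 _ (Psi x)) (gt_eqF p2) (negbTE Pn).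
have [_ _ ig0] := sg0; have [_ _ ig1] := sg1.
have iq : rint (fun x => `|g0 x - g1 x|) by apply: rint_norm; exact: rintB.
move: eqe; rewrite emean_rmean // (ae_eq_rmean iq (rint_cst 0) e0) rmean_cst.
by move=> -[e20]; rewrite -e20 ltxx in e2.
Qed.

Lemma saddle_f (eps1 alpha1 : R) (f1 f : R -> R) : ae_bounded (hfun_g a f0 g0) ->
  0 <= alpha1 -> spectral_density f1 -> D2 eps1 f1 f ->
  emean (fun x => `|f0 x - f1 x| ^+ 2) = eps1%:E ->
  ae_circle (fun x =>
    hnum_f a f0 g0 x = (f0 x + g0 x) ^+ 2 * (f0 x - f1 x) * alpha1) ->
  rmean (fun x => sqmod (trigpoly a x - hopt a f0 g0 x) * f x) <=
  rmean (fun x => sqmod (trigpoly a x - hopt a f0 g0 x) * f0 x).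
Proof.
move=> bh a1 [mf1 _ _] [sf fe] eqe eqf.
have [pp _] := minimality_positive sf0 sg0 hmin.
have isq u : spectral_density u ->
    (emean (fun x => `|u x - f1 x| ^+ 2)%R <= eps1%:E)%E ->
    rint (fun x => `|u x - f1 x| ^+ 2).
  move=> [mu _ _] ule; apply: rint_emean; last exact: le_lt_trans ule (ltry _).
    by apply: measurable_funX; apply: measurableT_comp => //; exact: measurable_funB.
  by move=> x _; rewrite exprn_ge0.
have i1 := isq _ sf fe; have i2 : rint (fun x => `|f0 x - f1 x| ^+ 2).
  by apply: isq => //; rewrite eqe.
have j1 := rint_sqmod_sub_hopt sf0 sg0 bh sf.
have j2 := rint_sqmod_sub_hopt sf0 sg0 bh sf0.
rewrite emean_rmean // lee_fin in fe; rewrite emean_rmean // in eqe.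
case: eqe => eqe.
(* The added term has mean at most 0, since f lies in the ball and f0 on its boundary. With it, the
   pointwise gap is alpha1 / 2 times (f - f0)^2. *)
apply: (@le_trans _ _ (rmean (fun x => sqmod (trigpoly a x - hopt a f0 g0 x) * f0 x
   + alpha1 / 2 * (`|f x - f1 x| ^+ 2 - `|f0 x - f1 x| ^+ 2)))).
  apply: le_rmean => //; first by apply: rintD => //; apply: rintZ; exact: rintB.
  apply: ae_circleS2 pp eqf => x cx px ex.
  have -> : sqmod (trigpoly a x - hopt a f0 g0 x) = (f0 x - f1 x) * alpha1.
    rewrite sqmod_sub_hopt // /hfun_f ex; field.
    by rewrite gt_eqF.
  rewrite !real_normK ?num_real // -subr_ge0.
  have -> : (f0 x - f1 x) * alpha1 * f0 x +
     alpha1 / 2 * ((f x - f1 x) ^+ 2 - (f0 x - f1 x) ^+ 2) -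
     (f0 x - f1 x) * alpha1 * f x = alpha1 / 2 * (f x - f0 x) ^+ 2 by field.
  by rewrite mulr_ge0 ?sqr_ge0 // divr_ge0.
rewrite rmeanD //; last by apply: rintZ; exact: rintB.
rewrite rmeanZ; last exact: rintB.
rewrite rmeanB // gerDl mulr_ge0_le0 ?divr_ge0 //.
by rewrite subr_le0 eqe.
Qed.

Lemma saddle_g (eps2 alpha2 : R) (g1 g Psi : R -> R) : ae_bounded (hfun_g a f0 g0) ->
  0 <= alpha2 -> spectral_density g1 -> D1 eps2 g1 g ->
  emean (fun x => `|g0 x - g1 x|) = eps2%:E ->
  ae_circle (fun x => `|Psi x| <= 1) ->
  ae_circle (fun x => g0 x != g1 x -> Psi x = Num.sg (g0 x - g1 x)) ->
  ae_circle (fun x =>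
    hnum_g a f0 g0 x = (f0 x + g0 x) ^+ 2 * Psi x * alpha2) ->
  rmean (fun x => sqmod (hopt a f0 g0 x) * g x) <=
  rmean (fun x => sqmod (hopt a f0 g0 x) * g0 x).
Proof.
move=> bh a2 [_ _ ig1] [sg ge] eqe P1 P2 eqg.
have [pp _] := minimality_positive sf0 sg0 hmin.
have [_ _ ig0] := sg0; have [_ _ ig] := sg.
have i1 : rint (fun x => `|g x - g1 x|) by apply: rint_norm; exact: rintB.
have i2 : rint (fun x => `|g0 x - g1 x|) by apply: rint_norm; exact: rintB.
have j1 := rint_sqmod_hopt sf0 sg0 bh sg.
have j2 := rint_sqmod_hopt sf0 sg0 bh sg0.
rewrite emean_rmean // lee_fin in ge; rewrite emean_rmean // in eqe.
case: eqe => eqe.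
have hP : ae_circle (fun x => hnum_g a f0 g0 x = (f0 x + g0 x) ^+ 2 * Psi x * alpha2
    /\ 0 < f0 x + g0 x).
  by apply: ae_circleS2 eqg pp => x _.
(* Again the added term has mean at most 0. The pointwise bound is the subgradient inequality for
   the absolute value, with [Psi] a subgradient at g0 - g1. *)
apply: (@le_trans _ _ (rmean (fun x => sqmod (hopt a f0 g0 x) * g0 x
   + alpha2 * (`|g x - g1 x| - `|g0 x - g1 x|)))).
  apply: le_rmean => //; first by apply: rintD => //; apply: rintZ; exact: rintB.
  apply: ae_circleS3 hP P1 P2 => x cx [ex px] P1x P2x.
  have -> : sqmod (hopt a f0 g0 x) = Psi x * alpha2.
    rewrite sqmod_hopt /hfun_g ex; field.
    by rewrite gt_eqF.
  have h1 : Psi x * (g x - g1 x) <= `|g x - g1 x|.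
    apply: le_trans (ler_norm _) _; rewrite normrM.
    by rewrite ler_piMl.
  have h2 : Psi x * (g0 x - g1 x) = `|g0 x - g1 x|.
    have [->|ne] := eqVneq (g0 x) (g1 x); first by rewrite subrr normr0 mulr0.
    by rewrite P2x // -normrEsg.
  have -> : Psi x * alpha2 * g x = Psi x * alpha2 * g0 x +
      alpha2 * (Psi x * (g x - g1 x) - Psi x * (g0 x - g1 x)) by ring.
  by rewrite h2 lerD2l ler_wpM2l // lerD2r.
rewrite rmeanD //; last by apply: rintZ; exact: rintB.
rewrite rmeanZ; last exact: rintB.
rewrite rmeanB // gerDl mulr_ge0_le0 //.
by rewrite subr_le0 eqe.
Qed.

End saddle_point.

Theorem theorem7p8 (R : realType) (N : nat) (a : 'cV[R[i]]_N.+1)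
    (eps1 eps2 : R) (heps1 : 0 < eps1) (heps2 : 0 < eps2)
    (f1 g1 : R -> R)
    (hf1 : spectral_density f1) (hg1 : spectral_density g1)
    (bf1 : ae_bounded f1) (bg1 : ae_bounded g1)
    (f0 g0 : R -> R) (hf0 : D2 eps1 f1 f0) (hg0 : D1 eps2 g1 g0)
    (hmin : minimality f0 g0)
    (bhf : ae_bounded (hfun_f a f0 g0)) (bhg : ae_bounded (hfun_g a f0 g0))
    (alpha1 alpha2 : R) (Psi : R -> R)
    (hPsi1 : ae_circle (fun x => `|Psi x| <= 1))
    (hPsi : ae_circle (fun x => g0 x != g1 x -> Psi x = Num.sg (g0 x - g1 x)))
    (eq_f : ae_circle (fun x =>
       hnum_f a f0 g0 x = (f0 x + g0 x) ^+ 2 * (f0 x - f1 x) * alpha1))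
    (eq_g : ae_circle (fun x =>
       hnum_g a f0 g0 x = (f0 x + g0 x) ^+ 2 * Psi x * alpha2))
    (eq_eps1 : emean (fun x => `|f0 x - f1 x| ^+ 2) = eps1%:E)
    (eq_eps2 : emean (fun x => `|g0 x - g1 x|) = eps2%:E)
    (hopt0 : solves_optimization a (D2 eps1 f1 `*` D1 eps2 g1) f0 g0) :
  least_favourable a (D2 eps1 f1 `*` D1 eps2 g1) f0 g0 /\
  minimax_robust a (D2 eps1 f1 `*` D1 eps2 g1) (hopt a f0 g0).
Proof.
have [sf0 _] := hf0; have [sg0 _] := hg0.
have a1 : 0 <= alpha1.
  exact: (multiplier_f_ge0 sf0 sg0 hmin heps1 hf1 hf0 hg0 eq_eps1 eq_f hopt0).
have a2 : 0 <= alpha2.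
  exact: (multiplier_g_ge0 sf0 sg0 hmin heps2 hg1 hg0 hf0 eq_eps2 hPsi eq_g hopt0).
have sc := hopt_spectral_characteristic sf0 sg0 hmin bhg.
have adm : admissible N (D2 eps1 f1 `*` D1 eps2 g1) (hopt a f0 g0).
  by move=> [f g] [[sf _] [sg _]]; exact: (L2N_hopt sf0 sg0 hmin bhg sf sg).
have saddle f g : D2 eps1 f1 f -> D1 eps2 g1 g ->
    (Delta a (hopt a f0 g0) f g <= Delta a (hopt a f0 g0) f0 g0)%E.
  move=> Df Dg; have [sf _] := Df; have [sg _] := Dg.
  rewrite !Delta_hopt // lee_fin lerD //.
    exact: (saddle_f sf0 sg0 hmin bhg a1 hf1 Df eq_eps1 eq_f).
  exact: (saddle_g sf0 sg0 hmin bhg a2 hg1 Dg eq_eps2 hPsi1 hPsi eq_g).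
split.
  split; first by split.
  exists (hopt a f0 g0) => //; split; first by exists f0, g0, (hopt a f0 g0).
  (* h0 is a competitor for every pair of D, so the least error at (f, g) is at most Delta(h0; f,
     g), which the saddle inequality bounds. *)
  move=> _ [f [g [h [[Df Dg] [_ hmin_h] ->]]]].
  by apply: le_trans (hmin_h _ (adm (f, g) (conj Df Dg))) _; exact: saddle.
split => //; split; first by exists (hopt a f0 g0).
move=> _ [h admh <-].
(* The saddle value separates the two worst errors: it bounds that of h0 from above, and that of [h]
   from below, because h0 is optimal at (f0, g0). *)
apply: (@le_trans _ _ (Delta a (hopt a f0 g0) f0 g0)).
  by apply: ge_ereal_sup => _ [[f g] [Df Dg] <-]; exact: saddle.
apply: le_trans (sc.2 _ (admh (f0, g0) (conj hf0 hg0))) _.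
by apply: ereal_sup_ubound; exists (f0, g0).
Qed.
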